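(* Let $t$ be an integer with $1\leq t\leq 5$ and let $n\geq t+1$. Then ${\cal S}_t(K_n)$ is the unique maximal abstract symmetric $t$-tensor matroid on $E(K_n)$ with respect to the weak order.
   Context: ${\cal S}_t(K_n)$ is the linear matroid on $E(K_n)$ obtained by choosing a generic map $p:V(K_n)\to\mathbb{R}^t$ (coordinates algebraically independent over $\mathbb{Q}$) and associating with each edge $ij$ the vector $p_i\otimes p_j+p_j\otimes p_i$; it does not depend on the generic choice. For $n\ge t+1$, an abstract symmetric $t$-tensor matroid on $E(K_n)$ is a matroid $M$ on $E(K_n)$ such that (R1* ) the rank of $M$ is $\binom{t+1}{2}$, and (R3* ) the edge set of every copy of $K_{1,t+1}$ in $K_n$ is a circuit of $M$. The weak order on matroids on a common ground set: $M\preceq N$ if every independent set of $M$ is independent in $N$. ''Unique maximal'' means the only maximal element of the family under $\preceq$ (equivalently, since the family is finite, its maximum). *)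

(* Defs.v *)
From HB Require Import structures.
From mathcomp Require Import all_boot all_order all_algebra reals.
From mathcomp Require Import mpoly.

Set Implicit Arguments.
Unset Strict Implicit.
Unset Printing Implicit Defensive.

Import GRing.Theory.
Local Open Scope ring_scope.

Section Matroid.
Variables (T : finType) (E : {set T}).

Definition is_matroid (I : {set {set T}}) : bool :=
  [&& set0 \in I,
      [forall A in I, A \subset E],
      [forall A in I, forall B : {set T}, (B \subset A) ==> (B \in I)]
    & [forall A in I, forall B in I,
         (#|A| < #|B|)%N ==> [exists x in B :\: A, x |: A \in I]]].

(* Being a subtype of [{set {set T}}], [matroid] has extensional Leibniz
   equality: two matroids are equal iff they have the same independent sets. *)
Record matroid := Matroid {
  indep : {set {set T}};
  indepP : is_matroid indep
}.

HB.instance Definition _ := [isSub for indep].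
HB.instance Definition _ := [Finite of matroid by <:].

Definition mrank (M : matroid) : nat := \max_(A in indep M) #|A|.

Definition circuit (M : matroid) (C : {set T}) : bool :=
  minset [pred A : {set T} | (A \subset E) && (A \notin indep M)] C.

Definition weak_le (M N : matroid) : bool := indep M \subset indep N.

Definition maximal_in (F : pred matroid) (M : matroid) : Prop :=
  F M /\ forall N, F N -> weak_le M N -> N = M.

Definition unique_maximal_in (F : pred matroid) (M : matroid) : Prop :=
  maximal_in F M /\ forall N, maximal_in F N -> N = M.

End Matroid.

Section LinearMatroid.
Variables (K : fieldType) (V : vectType K) (T : finType) (E : {set T}).
Variable f : T -> V.

(* [free] is applied to the family indexed by [A], so parallel elements
   (with the same image by [f]) are dependent. *)
Definition linear_indep : {set {set T}} :=
  [set A : {set T} | (A \subset E) && free [seq f x | x in A]].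

Lemma free_setU1 (A : {set T}) x : x \notin A ->
  free [seq f y | y in x |: A] = free (f x :: [seq f y | y in A]).
Proof.
move=> xA; rewrite /image_mem -map_cons; apply/perm_free/perm_map/uniq_perm.
- exact: enum_uniq.
- by rewrite /= mem_enum xA enum_uniq.
- by move=> y; rewrite inE !mem_enum !inE.
Qed.

Lemma linear_is_matroid : is_matroid E linear_indep.
Proof.
apply/and4P; split.
- by rewrite inE sub0set /image_mem enum_set0 nil_free.
- by apply/forall_inP => A; rewrite inE => /andP[].
- apply/forall_inP => A; rewrite inE => /andP[AE fA].
  apply/forallP => B; apply/implyP => BA.
  rewrite inE (subset_trans BA AE) /=.
  have pAB : perm_eq (enum A) (enum B ++ enum (A :\: B)).
    apply: uniq_perm; first exact: enum_uniq.
      rewrite cat_uniq !enum_uniq andbT /=; apply/hasPn => y.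
      by rewrite !mem_enum inE => /andP[].
    move=> y; rewrite mem_cat !mem_enum inE.
    by case: (boolP (y \in B)) => //= /(subsetP BA).
  move: fA; rewrite /image_mem (perm_free (perm_map f pAB)) map_cat.
  exact: catl_free.
- apply/forall_inP => A; rewrite inE => /andP[AE fA].
  apply/forall_inP => B; rewrite inE => /andP[BE fB].
  apply/implyP; apply: contraLR => /exists_inPn nx; rewrite -leqNgt.
  have sAB : (<<[seq f y | y in B]>> <= <<[seq f y | y in A]>>)%VS.
    apply/span_subvP => _ /imageP[x xB ->].
    have [xA|xA] := boolP (x \in A).
      by apply/memv_span/imageP; exists x.
    have := nx x; rewrite !inE xA xB => /(_ isT).
    rewrite subUset sub1set (subsetP BE _ xB) AE free_setU1 //= free_cons fA.
    by rewrite andbT negbK.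
  have := dimvS sAB; rewrite (eqP fA) (eqP fB).
  by rewrite !size_image.
Qed.

Definition linear_matroid : matroid E := Matroid linear_is_matroid.

End LinearMatroid.

Definition complete_edges (n : nat) : {set {set 'I_n}} :=
  [set e : {set 'I_n} | #|e| == 2].

Definition star (n : nat) (v : 'I_n) (L : {set 'I_n}) : {set {set 'I_n}} :=
  [set [set v; w] | w in L].

(* The copies of K_{1,t+1} in K_n are the stars with centre [v] and set of
   leaves [L], for [v \notin L] and [#|L| = t.+1]. *)
Definition abstract_symmetric_tensor (n t : nat) :
    pred (matroid (complete_edges n)) :=
  fun M =>
    (mrank M == 'C(t.+1, 2)) &&
    [forall v : 'I_n, forall L : {set 'I_n},
      (v \notin L) && (#|L| == t.+1) ==> circuit M (star v L)].

Definition alg_independent (R : realType) (m : nat) (x : 'I_m -> R) : Prop :=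
  forall q : {mpoly rat[m]}, mmap ratr x q = 0 -> q = 0.

(* The point [p_i] is [row i p]. *)
Definition generic (R : realType) (n t : nat) (p : 'M[R]_(n, t)) : Prop :=
  alg_independent (fun k => mxvec p 0 k).

(* Tensors are represented by matrices, with [x^T *m y] for x (x) y; for
   [e = [set i; j]] with [i != j] the sum has the two terms
   p_i (x) p_j and p_j (x) p_i. *)
Definition edge_tensor (R : realType) (n t : nat) (p : 'M[R]_(n, t))
    (e : {set 'I_n}) : 'M[R]_t :=
  \sum_(i in e) \sum_(j in e | j != i) (row i p)^T *m row j p.

Definition symmetric_tensor_matroid (R : realType) (n t : nat)
    (p : 'M[R]_(n, t)) : matroid (complete_edges n) :=
  linear_matroid (complete_edges n) (edge_tensor p).

(* Main.v *)
Require Import Defs.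
From mathcomp Require Import all_boot all_order all_algebra reals.
From mathcomp Require Import mpoly.
From mathcomp Require Import zify lra.

(** A set F of 'C(t+1,2) edges is a basis of S_t(K_n) iff, for some placement p,
    the only symmetric matrix W with p_i W p_j^T = 0 for all ij in F is 0.  This
    property passes from dimension t-1 to dimension t when a vertex v of degree t
    is added, or a vertex v of degree t-1 together with an edge that avoids the
    neighbours of v; it also survives undoing a compression, which replaces the
    neighbourhoods of two nonadjacent vertices by their union and intersection
    (put p_u close to p_v).  Conversely let F be a basis of an abstract symmetric
    t-tensor matroid M.  Deleting a vertex of degree t or t-1 (in the latter case
    with a suitable edge) gives a basis of the contraction of M by the star of v,
    because k vertices are incident with a set of rank at most
    'C(t+1,2) - 'C(t+1-k,2).  By induction on t all degrees of F may thus be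
    assumed to be at most t-2, and for t <= 5 such an F is shown to be a basis of
    S_t(K_n) directly: for t = 5 by compressing a pair of vertices with 4 or 5
    neighbours, which exists, after compressing pairs with fewer neighbours if
    all degrees are at most 2, unless F is the disjoint union of K_4 and K_{3,3};
    for that graph explicit points are given. *)

Set Implicit Arguments.
Unset Strict Implicit.
Unset Printing Implicit Defensive.

(** * Rank in a matroid *)

Section Rank.
Variables (T : finType) (E : {set T}) (M : matroid E).
Implicit Types A B C : {set T}.

Definition rank A : nat := \max_(B in indep M | B \subset A) #|B|.

Lemma indep0 : set0 \in indep M.
Proof. by case/and4P: (indepP M). Qed.

Lemma indep_ground A : A \in indep M -> A \subset E.
Proof. by case/and4P: (indepP M) => _ /forall_inP h _ _; apply: h. Qed.

Lemma indepS A B : B \subset A -> A \in indep M -> B \in indep M.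
Proof.
case/and4P: (indepP M) => _ _ /forall_inP h _ sBA /h /forallP /(_ B).
by rewrite sBA.
Qed.

Lemma indep_augment A B : A \in indep M -> B \in indep M -> #|A| < #|B| ->
  exists2 x, x \in B :\: A & x |: A \in indep M.
Proof.
case/and4P: (indepP M) => _ _ _ /forall_inP h /h /forall_inP h' /h' + ltAB.
by rewrite ltAB => /exists_inP[x]; exists x.
Qed.

Lemma leq_card_rank A B : B \in indep M -> B \subset A -> #|B| <= rank A.
Proof. by move=> iB sBA; apply: (bigmax_sup B); rewrite ?iB. Qed.

Lemma rank_extend A B : B \in indep M -> B \subset A ->
  exists C, [/\ C \in indep M, B \subset C, C \subset A & #|C| = rank A].
Proof.
move=> iB sBA.
have [D /andP[iD sDA] rD] : {D | (D \in indep M) && (D \subset A) & rank A = #|D|}.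
  by apply: eq_bigmax_cond; apply/card_gt0P; exists B; rewrite unfold_in iB.
have [k] := ubnP (#|D| - #|B|); elim: k B iB sBA => // k IH B iB sBA ltk.
have [leDB|ltBD] := leqP #|D| #|B|.
  exists B; split=> //; apply/eqP; rewrite eqn_leq leq_card_rank //.
  by rewrite rD.
have [x /setDP[xD xB] ixB] := indep_augment iB iD ltBD.
have [||C [iC sC sCA cC]] := IH (x |: B) ixB.
- by rewrite subUset sub1set (subsetP sDA).
- by rewrite cardsU1 xB; lia.
- by exists C; split=> //; apply: subset_trans sC; apply: subsetUr.
Qed.

Lemma rank_leq_card A : rank A <= #|A|.
Proof. by apply/bigmax_leqP => B /andP[_ /subset_leq_card]. Qed.

Lemma rankS A B : A \subset B -> rank A <= rank B.
Proof.
move=> sAB; apply/bigmax_leqP => C /andP[iC sCA].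
by apply: leq_card_rank iC (subset_trans sCA sAB).
Qed.

Lemma rank_indep A : A \in indep M -> rank A = #|A|.
Proof. by move=> iA; apply/eqP; rewrite eqn_leq rank_leq_card leq_card_rank. Qed.

Lemma indep_rank A : rank A = #|A| -> A \in indep M.
Proof.
move=> rA; have [C [iC _ sCA cC]] := rank_extend indep0 (sub0set A).
suff <- : C = A by [].
by apply/eqP; rewrite eqEcard sCA cC rA leqnn.
Qed.

(** A basis [I] of [A :&: B] is extended to a basis [J] of [A :|: B]; [J] meets [A] and [B] in
    independent sets that share at least [I]. *)
Lemma rank_submod A B : rank (A :|: B) + rank (A :&: B) <= rank A + rank B.
Proof.
have [I [iI _ sI cI]] := rank_extend indep0 (sub0set (A :&: B)).
have sIU : I \subset A :|: B.
  by apply: subset_trans sI _; apply: subset_trans (subsetIl _ _) (subsetUl _ _).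
have [J [iJ sIJ sJ cJ]] := rank_extend iI sIU.
have JA : #|J :&: A| <= rank A.
  by apply: leq_card_rank (subsetIr _ _); apply: indepS iJ; apply: subsetIl.
have JB : #|J :&: B| <= rank B.
  by apply: leq_card_rank (subsetIr _ _); apply: indepS iJ; apply: subsetIl.
have := cardsUI (J :&: A) (J :&: B).
rewrite -setIUr (setIidPl sJ) setIACA setIid.
have : #|I| <= #|J :&: (A :&: B)| by apply: subset_leq_card; rewrite subsetI sIJ.
lia.
Qed.

Lemma rankU_leq A B : rank (A :|: B) <= rank A + #|B|.
Proof. by have := rank_submod A B; have := rank_leq_card B; lia. Qed.

(** Monotonicity of closure, read off from submodularity for [x |: A] and [B]. *)
Lemma rankU1_mono A B x : rank (x |: A) = rank A -> A \subset B ->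
  rank (x |: B) = rank B.
Proof.
move=> rx sAB; apply/eqP; rewrite eqn_leq [X in _ && X]rankS ?subsetUr // andbT.
have := rank_submod (x |: A) B; rewrite -setUA (setUidPr sAB).
have : rank A <= rank ((x |: A) :&: B) by apply: rankS; rewrite subsetI subsetUr.
by rewrite rx; lia.
Qed.

Lemma rankU_id A B : {in B, forall x, rank (x |: A) = rank A} ->
  rank (A :|: B) = rank A.
Proof.
have [k] := ubnP #|B|; elim: k B => // k IH B ltk hB.
have [->|[x xB]] := set_0Vmem B; first by rewrite setU0.
have eB : B = x |: (B :\ x) by rewrite setD1K.
rewrite eB setUCA (@rankU1_mono A) ?hB ?subsetUl // IH.
  by rewrite -[rank A](hB x).
  by rewrite (cardsD1 x) xB in ltk; lia.
by move=> y /setD1P[_ /hB].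
Qed.

(** The elements of [B :\: C] are coloops modulo [A]. Each one raises the rank when added to [C]:
    otherwise it would lie in the closure of [A :|: C], hence in that of [A :|: B :\ x]. *)
Lemma rank_coloops A B C : C \subset B ->
  {in B :\: C, forall x, rank (A :|: B :\ x) < rank (A :|: B)} ->
  rank (A :|: C) + #|B :\: C| <= rank (A :|: B).
Proof.
have [k] := ubnP #|B :\: C|; elim: k C => // k IH C ltk sCB hC.
have [e0|[x xBC]] := set_0Vmem (B :\: C).
  by rewrite e0 cards0 addn0 rankS // setUS.
have [xB xC] := setDP xBC.
have eD : B :\: (x |: C) = (B :\: C) :\ x.
  by rewrite [x |: C]setUC -setDDl.
have cD : #|B :\: C| = #|B :\: (x |: C)|.+1 by rewrite (cardsD1 x) xBC eD.
have le1 : rank (A :|: (x |: C)) + #|B :\: (x |: C)| <= rank (A :|: B).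
  apply: IH => [||y]; first by rewrite -ltnS -cD.
    by rewrite subUset sub1set xB.
  by rewrite eD => /setD1P[_]; apply: hC.
suff : rank (A :|: C) < rank (A :|: (x |: C)) by rewrite cD; lia.
rewrite ltn_neqAle rankS ?setUS ?subsetUr // andbT; apply/eqP => eq1.
have := hC _ xBC; have sC : A :|: C \subset A :|: B :\ x.
  by rewrite setUS // subsetD1 sCB.
rewrite setUCA in eq1.
by rewrite -(rankU1_mono (esym eq1) sC) setUCA setD1K // ltnn.
Qed.

End Rank.

(** * Graphs as sets of edges *)

Section Graph.
Variable T : finType.
Implicit Types (F G : {set {set T}}) (X A : {set T}).

Definition simple F : bool := F \subset [set e : {set T} | #|e| == 2].

Definition nbr F v : {set T} := [set w | [set v; w] \in F].

Definition del F v : {set {set T}} := [set e in F | v \notin e].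

Lemma in_nbr F v w : (w \in nbr F v) = ([set v; w] \in F).
Proof. by rewrite inE. Qed.

Lemma nbr_sym F v w : (w \in nbr F v) = (v \in nbr F w).
Proof. by rewrite !inE setUC. Qed.

Lemma set2_inj (v : T) : injective (fun w => [set v; w]).
Proof.
move=> w x /setP e; have := e w; have := e x; rewrite !inE !eqxx !orbT.
by case: eqP => [-> _|_ /eqP //]; case: eqP => //= _ /esym/eqP.
Qed.

Lemma in_star a b v A : ([set a; b] \in [set [set v; w] | w in A]) =
  (a == v) && (b \in A) || (b == v) && (a \in A).
Proof.
apply/imsetP/idP => [[w wA e]|].
  have : v \in [set a; b] by rewrite e set21.
  rewrite !inE => /orP[] /eqP vE; subst v.
    by rewrite (set2_inj e) eqxx wA.
  by rewrite setUC in e; rewrite (set2_inj e) eqxx wA orbT.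
by case/orP => /andP[/eqP-> h]; [exists b | exists a; rewrite // setUC].
Qed.

Lemma simpleP F e : simple F -> e \in F -> exists x y, x != y /\ e = [set x; y].
Proof.
move=> sF eF; have /cards2P[x [y [xy ->]]] : #|e| == 2.
  by have := subsetP sF e eF; rewrite inE.
by exists x, y.
Qed.

Lemma simple_neq F v w : simple F -> w \in nbr F v -> v != w.
Proof.
move=> sF; rewrite inE => /(subsetP sF); rewrite inE cards2.
by case: (v != w).
Qed.

Lemma nbr_irr F v : simple F -> v \notin nbr F v.
Proof. by move=> sF; apply/negP => /(simple_neq sF); rewrite eqxx. Qed.

Lemma edge_nbr F e x : simple F -> e \in F -> x \in e ->
  exists2 y, y \in nbr F x & e = [set x; y].
Proof.
move=> sF eF; have [a [b [_ eE]]] := simpleP sF eF; rewrite eE !inE.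
case/orP=> /eqP ->; [exists b|exists a]; rewrite ?inE -?eE //.
  by rewrite setUC -eE.
by rewrite eE setUC.
Qed.

Lemma simple_del F v : simple F -> simple (del F v).
Proof. by apply: subset_trans; apply/subsetP => e /setIdP[]. Qed.

Lemma simpleS F G : G \subset F -> simple F -> simple G.
Proof. exact: subset_trans. Qed.

Lemma del_sub F v : del F v \subset F.
Proof. by apply/subsetP => e /setIdP[]. Qed.

Lemma card_inc F v : simple F -> #|[set e in F | v \in e]| = #|nbr F v|.
Proof.
move=> sF; rewrite -(card_imset _ (@set2_inj v)); apply: eq_card => e.
rewrite inE; apply/andP/imsetP => [[eF ve]|[w]].
  by have [w wN ->] := edge_nbr sF eF ve; exists w.
by rewrite inE => h ->; rewrite h set21.
Qed.

Lemma card_del F v : simple F -> #|nbr F v| + #|del F v| = #|F|.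
Proof.
move=> sF; rewrite -card_inc // -(cardsID [set e : {set T} | v \in e] F).
by congr (_ + _); apply: eq_card => e; rewrite !inE // andbC.
Qed.

Lemma in_nbr_del F v x y :
  (y \in nbr (del F v) x) = [&& y \in nbr F x, v != x & v != y].
Proof. by rewrite !inE negb_or. Qed.

Lemma nbr_sub F G x : G \subset F -> nbr G x \subset nbr F x.
Proof. by move=> s; apply/subsetP => y; rewrite !inE; apply: subsetP. Qed.

Lemma nbr_del F v x : v != x -> nbr (del F v) x = nbr F x :\ v.
Proof.
by move=> vx; apply/setP => y; rewrite in_nbr_del in_setD1 vx andbC /= eq_sym.
Qed.

Lemma nbr_del_id F v : nbr (del F v) v = set0.
Proof. by apply/setP => y; rewrite in_nbr_del eqxx andbF inE. Qed.

Lemma leq_card_avoid F X : simple F ->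
  #|F| <= \sum_(x in X) #|nbr F x| + #|[set e in F | [disjoint e & X]]|.
Proof.
move=> sF; rewrite -(cardsID [set e : {set T} | [disjoint e & X]] F) addnC.
apply: leq_add; last by apply: subset_leq_card; apply/subsetP => e; rewrite !inE.
under eq_bigr => x _ do rewrite -card_inc //.
have sub : F :\: [set e : {set T} | [disjoint e & X]] \subset
    \bigcup_(x in X) [set e in F | x \in e].
  apply/subsetP => e; rewrite !inE => /andP[/pred0Pn[x /= /andP[xe xX]] eF].
  by apply/bigcupP; exists x; rewrite // inE eF.
apply: leq_trans (subset_leq_card sub) _.
elim/big_rec2: _ => [|x m A _ IH]; first by rewrite cards0.
by apply: leq_trans (leq_card_setU _ _) _; rewrite leq_add2l.
Qed.

Lemma edge_avoid F X : simple F -> \sum_(x in X) #|nbr F x| < #|F| ->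
  exists2 e, e \in F & [disjoint e & X].
Proof.
move=> sF lt; have := leq_card_avoid X sF.
have [->|[e]] := set_0Vmem [set e in F | [disjoint e & X]].
  by rewrite cards0; lia.
by rewrite inE => /andP[]; exists e.
Qed.

(** Stars of pairwise nonadjacent vertices are disjoint: deleting one such vertex leaves the
    neighbourhoods of the others unchanged. *)
Lemma leq_sum_stars F (X : seq T) : simple F -> uniq X ->
  {in X &, forall x y, y \notin nbr F x} ->
  \sum_(x <- X) #|nbr F x| <= #|F|.
Proof.
elim: X F => [|x X IH] F sF /=; first by rewrite big_nil.
case/andP=> xX uX hX; rewrite big_cons -(card_del x sF) leq_add2l.
have -> : \sum_(y <- X) #|nbr F y| = \sum_(y <- X) #|nbr (del F x) y|.
  apply: eq_big_seq => y yX; apply: eq_card => z; rewrite in_nbr_del.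
  have -> : x != y by apply: contraNneq xX => ->.
  case: eqP => [<-|]; rewrite ?andbT // andbF.
  by apply/negbTE/hX; rewrite inE ?eqxx ?yX ?orbT.
apply: IH => //; first exact: simple_del.
by move=> y z yX zX; rewrite in_nbr_del negb_and hX // inE ?yX ?zX orbT.
Qed.

Lemma handshake F : simple F -> \sum_v #|nbr F v| = #|F|.*2.
Proof.
move=> sF; under eq_bigr => v _ do rewrite -card_inc // -sum1_card.
rewrite (exchange_big_dep (mem F)) /=; last by move=> v e _; rewrite inE => /andP[].
rewrite -muln2 -sum_nat_const; apply: eq_bigr => e eF.
have := subsetP sF e eF; rewrite inE => /eqP <-; rewrite -sum1_card.
by apply: eq_bigl => v; rewrite !inE eF.
Qed.

Lemma card_support F d : simple F -> (forall v, #|nbr F v| <= d) ->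
  #|F|.*2 <= d * #|[set v | nbr F v != set0]|.
Proof.
move=> sF hd; rewrite -handshake // (bigID (fun v => nbr F v != set0)) /=.
rewrite [X in _ + X]big1 ?addn0 => [|v]; last by rewrite negbK => /eqP->; rewrite cards0.
rewrite mulnC -sum_nat_const [leqRHS](eq_bigl (fun v => nbr F v != set0)).
  exact: leq_sum.
by move=> v; rewrite inE.
Qed.

(** * Compression of two nonadjacent vertices *)

Section Compress.
Variables (F : {set {set T}}) (u v : T).
Hypotheses (sF : simple F) (uv : u != v) (nuv : v \notin nbr F u).

(** Edges at [u] are moved to [v]; those going to common neighbours stay at [u] as well, since [v]
    already has them, so the number of edges is preserved. *)
Definition compress : {set {set T}} :=
  del F u :|: [set [set v; w] | w in nbr F u]
          :|: [set [set u; w] | w in nbr F u :&: nbr F v].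

Let nvu : u \notin nbr F v. Proof. by rewrite nbr_sym. Qed.

Lemma in_compress a b : [set a; b] \in compress =
  [|| [&& [set a; b] \in F, u != a & u != b],
      (a == v) && (b \in nbr F u), (b == v) && (a \in nbr F u),
      (a == u) && (b \in nbr F u :&: nbr F v)
    | (b == u) && (a \in nbr F u :&: nbr F v)].
Proof.
by rewrite in_setU in_setU !in_star inE in_set2 negb_or -!orbA.
Qed.

Lemma nbr_compress_v : nbr compress v = nbr F u :|: nbr F v.
Proof.
apply/setP => w; rewrite in_nbr in_compress eqxx /= uv in_setU -!in_nbr.
rewrite !in_setI !(negbTE nuv) (eq_sym v) (negbTE uv) /= !andbF.
case: eqP => [<-|_]; first by rewrite (negbTE nvu) /= !orbF.
by rewrite andbT !orbF orbC.
Qed.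

Lemma nbr_compress_u : nbr compress u = nbr F u :&: nbr F v.
Proof.
apply/setP => w; rewrite in_nbr in_compress eqxx andbF /= (negbTE uv) /=.
have hu := negbTE (nbr_irr u sF); rewrite !in_setI hu /= !andbF /=.
by rewrite orbF.
Qed.

Lemma simple_compress : simple compress.
Proof.
rewrite /simple !subUset (subset_trans (del_sub _ _) sF) /=.
apply/andP; split; apply/subsetP => _ /imsetP[w wN ->]; rewrite inE cards2.
  by case: (v =P w) => // vw; rewrite -vw (negbTE nuv) in wN.
by case: (u =P w) => // vw; rewrite -vw in_setI (negbTE (nbr_irr u sF)) in wN.
Qed.

Lemma del_compress : del (del compress u) v = del (del F u) v.
Proof.
apply/setP => e; rewrite !inE; case: (boolP (u \in e)) => ue; rewrite ?andbF //=.
case: (boolP (v \in e)) => ve; rewrite ?andbF ?andbT //=.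
have -> : (e \in [set [set v; w] | w in nbr F u]) = false.
  by apply/negP => /imsetP[w _ eE]; rewrite eE set21 in ve.
rewrite orbF.
have -> : (e \in [set [set u; w] | w in nbr F u :&: nbr F v]) = false.
  by apply/negP => /imsetP[w _ eE]; rewrite eE set21 in ue.
by rewrite orbF.
Qed.

Lemma card_compress : #|compress| = #|F|.
Proof.
have sC := simple_compress.
rewrite -(card_del u sF) -(card_del v (simple_del u sF)).
rewrite -(card_del u sC) -(card_del v (simple_del u sC)) del_compress.
rewrite !nbr_del // nbr_compress_u nbr_compress_v.
have -> : (nbr F u :|: nbr F v) :\ u = nbr F u :|: nbr F v.
  apply/setP => w; rewrite in_setD1; case: eqP => //= ->.
  by rewrite in_setU (negbTE nvu) (negbTE (nbr_irr u sF)).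
have -> : nbr F v :\ u = nbr F v.
  by apply/setP => w; rewrite in_setD1; case: eqP => //= ->; rewrite (negbTE nvu).
by rewrite addnA [_ + #|_ :|: _|]addnC cardsUI addnA.
Qed.

Lemma in_nbr_compress w x : w != u -> w != v ->
  (x \in nbr compress w) =
    [|| (x \in nbr F w) && (u != x), (x == v) && (w \in nbr F u)
      | (x == u) && (w \in nbr F u :&: nbr F v)].
Proof.
move=> wu wv.
by rewrite in_nbr in_compress (negbTE wu) (negbTE wv) -in_nbr eq_sym wu.
Qed.

Lemma nbr_compress_out w : w != u -> w != v -> w \notin nbr F u ->
  nbr compress w = nbr F w.
Proof.
move=> wu wv wNu; apply/setP => x.
rewrite in_nbr_compress // in_setI (negbTE wNu) /= !andbF !orbF.
by case: (u =P x) => [<-|]; rewrite ?andbT // nbr_sym (negbTE wNu).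
Qed.

(* Away from [u] and [v], compression only replaces a neighbour [u] by [v]. *)
Lemma nbr_compress w : w != u -> w != v -> #|nbr compress w| = #|nbr F w|.
Proof.
move=> wu wv.
have [wNu|wNu] := boolP (w \in nbr F u); last by rewrite nbr_compress_out.
have [wNv|wNv] := boolP (w \in nbr F v).
  apply: eq_card => x; rewrite in_nbr_compress // in_setI wNu wNv !andbT.
  have [->|_] := eqVneq x v; first by rewrite (nbr_sym F w) wNv !orbT.
  by have [->|_] := eqVneq x u; rewrite ?(nbr_sym F w) ?wNu ?orbT //= andbT orbF.
have -> : nbr compress w = v |: (nbr F w :\ u).
  apply/setP => x; rewrite in_nbr_compress // in_setI wNu (negbTE wNv) /= !andbF.
  by rewrite andbT orbF in_setU1 in_setD1 orbC (eq_sym u) [_ && (x != u)]andbC.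
rewrite cardsU1 in_setD1 nbr_sym (negbTE wNv) andbF /=.
by rewrite (cardsD1 u (nbr F w)) nbr_sym wNu.
Qed.

End Compress.
End Graph.

(** * Degree bounds, distant vertices, and graphs without a useful compression *)

Section Configurations.
Variable T : finType.
Implicit Types (F G : {set {set T}}) (X : {set T}).

Definition maxdeg F d := forall v, #|nbr F v| <= d.

Lemma maxdegS F G d : G \subset F -> maxdeg F d -> maxdeg G d.
Proof.
by move=> s h v; apply: leq_trans (h v); apply/subset_leq_card/nbr_sub.
Qed.

Lemma maxdeg_case F d : maxdeg F d.+1 ->
  maxdeg F d \/ exists v, #|nbr F v| = d.+1.
Proof.
move=> h; have [v /eqP|none] := pickP [pred v | #|nbr F v| == d.+1].
  by right; exists v.
by left => v; have := h v; have := none v; rewrite /= leq_eqVlt => ->.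
Qed.

Lemma edge_avoid_in F X d k : simple F -> {in X, forall x, #|nbr F x| <= d} ->
  #|X| <= k -> k * d < #|F| -> exists2 e, e \in F & [disjoint e & X].
Proof.
move=> sF hd hk lt; apply: edge_avoid sF (leq_ltn_trans _ lt).
apply: leq_trans (leq_mul hk (leqnn d)).
by rewrite -sum_nat_const; apply: leq_sum.
Qed.

Lemma disjoint_nbr_edge F e v : simple F -> e \in F ->
  [disjoint e & nbr F v] -> v \notin e.
Proof.
move=> sF eF dN; apply/negP => ve; have [w wN eE] := edge_nbr sF eF ve.
by have := disjointFl dN wN; rewrite eE set22.
Qed.

Lemma card_del_edge F e v : simple F -> e \in F -> [disjoint e & nbr F v] ->
  #|nbr F v| + #|del F v :\ e| = #|F|.-1.
Proof.
move=> sF eF dN; rewrite -(card_del v sF) (cardsD1 e (del F v)) inE eF.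
by rewrite (disjoint_nbr_edge sF eF dN) /=; lia.
Qed.

Lemma edge_support F e v : e \in F -> v \in e -> simple F -> nbr F v != set0.
Proof.
move=> eF ve sF; have [w wN _] := edge_nbr sF eF ve.
by apply/set0Pn; exists w.
Qed.

(** In a simple graph of maximum degree 3, three vertices with the same three neighbours are exactly
    one side of a copy of $K_{3,3}$. *)
Definition K33_free F := forall x y z, x != y -> x != z -> y != z ->
  nbr F x = nbr F y -> nbr F x = nbr F z -> #|nbr F x| != 3.

(** From a nonisolated [v], walks of length one or two reach at most [d + d * d] vertices, [v] among
    them. The handshake bound gives more nonisolated vertices than that, so one of them is at
    distance at least 3 from [v]. *)
Lemma far_pair F d : simple F -> maxdeg F d -> d * (d + d * d) < #|F|.*2 ->
  exists u v, [/\ u != v, v \notin nbr F u, nbr F u != set0, nbr F v != set0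
                & [disjoint nbr F u & nbr F v]].
Proof.
move=> sF dF ltF; have [e eF] : exists e, e \in F by apply/card_gt0P; lia.
have [v [w [vw eE]]] := simpleP sF eF; have vN : nbr F v != set0.
  by apply: (edge_support eF) => //; rewrite eE set21.
pose B := nbr F v :|: \bigcup_(w in nbr F v) nbr F w.
have cB : #|B| <= d + d * d.
  apply: leq_trans (leq_card_setU _ _) _; apply: leq_add => //.
  apply: (@leq_trans (\sum_(w in nbr F v) #|nbr F w|)).
    elim/big_rec2: _ => [|x m A _ IH]; first by rewrite cards0.
    by apply: leq_trans (leq_card_setU _ _) _; rewrite leq_add2l.
  apply: leq_trans (_ : #|nbr F v| * d <= _); last by rewrite leq_mul2r dF orbT.
  by rewrite -sum_nat_const; apply: leq_sum => x _; apply: dF.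
have [u uS uB] : exists2 u, nbr F u != set0 & u \notin B.
  have [u /andP[uS uB]|none] := pickP [pred u | (nbr F u != set0) && (u \notin B)].
    by exists u.
  have sub : [set u | nbr F u != set0] \subset B.
    apply/subsetP => u; rewrite inE => uS; have := none u.
    by rewrite /= uS => /negbFE.
  have := card_support sF dF; have := subset_leq_card sub; nia.
move: uB; rewrite in_setU negb_or => /andP[uv /bigcupP uB].
exists u, v; split=> //.
- apply/eqP => uE; apply: uB; have /set0Pn[x xN] := vN.
  by exists x; rewrite // uE nbr_sym.
- by rewrite nbr_sym.
- rewrite disjoints_subset; apply/subsetP => x xu; rewrite inE.
  by apply/negP => xv; apply: uB; exists x; rewrite // nbr_sym.
Qed.

Section CompressFar.
Variables (F : {set {set T}}) (u v : T).
Hypotheses (sF : simple F) (uv : u != v) (nuv : v \notin nbr F u).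

Lemma maxdeg_compress d : maxdeg F d -> #|nbr F u :|: nbr F v| <= d ->
  maxdeg (compress F u v) d.
Proof.
move=> dF dD w; have [->|wu] := eqVneq w u.
  rewrite nbr_compress_u //; apply: leq_trans (dF u).
  by apply/subset_leq_card/subsetIl.
have [->|wv] := eqVneq w v; first by rewrite nbr_compress_v.
by rewrite nbr_compress.
Qed.

(** Only [v] can gain degree in a compression, and [v] is deleted here. *)
Lemma maxdeg_del_compress d : maxdeg F d ->
  maxdeg (del (compress F u v) v) d.
Proof.
move=> dF w; have [->|wv] := eqVneq w v; first by rewrite nbr_del_id cards0.
apply: leq_trans (subset_leq_card (nbr_sub w (del_sub _ _))) _.
have [->|wu] := eqVneq w u; last by rewrite nbr_compress.
rewrite nbr_compress_u //; apply: leq_trans (dF u).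
by apply/subset_leq_card/subsetIl.
Qed.

(** Without common neighbours [u] becomes isolated; this is the measure that decreases in the
    inductions by repeated compression. *)
Lemma support_compress : [disjoint nbr F u & nbr F v] -> nbr F u != set0 ->
  nbr F v != set0 -> #|[set w | nbr (compress F u v) w != set0]| <
                     #|[set w | nbr F w != set0]|.
Proof.
move=> dN uN vN; apply: proper_card; apply/properP; split.
  apply/subsetP => w; rewrite !inE; have [->|wu] := eqVneq w u; first by [].
  have [->|wv] := eqVneq w v; first by [].
  by rewrite -!card_gt0 nbr_compress.
exists u; first by rewrite inE.
by rewrite inE nbr_compress_u // disjoint_setI0 // eqxx.
Qed.

Lemma card_disjoint_nbr : [disjoint nbr F u & nbr F v] ->
  #|nbr F u :|: nbr F v| = #|nbr F u| + #|nbr F v|.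
Proof. by move=> d; rewrite cardsU disjoint_setI0 // cards0 subn0. Qed.

End CompressFar.

(** Compressing such a pair gives [v] degree 4 or 5, the degrees at which a vertex can be removed in
    passing from dimension 5 to dimension 4. *)
Definition good_pair F u v :=
  [&& u != v, v \notin nbr F u, 4 <= #|nbr F u :|: nbr F v|
    & #|nbr F u :|: nbr F v| <= 5].

(** * Fifteen edges, no $K_{3,3}$ and no good pair exclude vertices of degree 3 *)

Section Cubic.
Variable F : {set {set T}}.
Hypotheses (sF : simple F) (cF : #|F| = 15) (dF : maxdeg F 3) (kF : K33_free F).
Hypothesis no_good : forall u v, ~~ good_pair F u v.

(** As the pair is not good, the union of the neighbourhoods has at most 3 or at least 6 elements;
    both extremes are rigid because degrees are at most 3. *)
Lemma nbr_dichotomy u v : #|nbr F v| = 3 -> u != v -> v \notin nbr F u ->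
  (nbr F u \subset nbr F v) \/
  (#|nbr F u| = 3 /\ [disjoint nbr F u & nbr F v]).
Proof.
move=> dv uv nuv; have := no_good u v; rewrite /good_pair uv nuv /=.
have cU := cardsUI (nbr F u) (nbr F v); have du := dF u.
rewrite negb_and -ltnNge -ltnNge => /orP[lt|gt]; [left|right].
  have : nbr F v == nbr F u :|: nbr F v.
    by rewrite eqEcard subsetUr dv -ltnS.
  by move/eqP->; apply: subsetUl.
split; first by lia.
by rewrite -setI_eq0 -cards_eq0; lia.
Qed.

(** An edge avoiding [nbr F v0] provides a second vertex [w] of degree 3 with neighbourhood disjoint
    from that of [v0]. Any other [u] is compared with [v0] and [w]; a nonempty [nbr F u] cannot lie
    in both neighbourhoods. *)
Lemma cubic v0 u : #|nbr F v0| = 3 -> nbr F u != set0 -> #|nbr F u| = 3.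
Proof.
move=> d0 uN.
have [e eF de] := edge_avoid_in (X := nbr F v0) (d := 3) (k := 3) sF
  (fun x _ => dF x) (eq_leq d0) ltac:(by rewrite cF).
have [w [b [wb eE]]] := simpleP sF eF.
have wb' : b \in nbr F w by rewrite in_nbr -eE.
have wN : w \notin nbr F v0 by rewrite (disjointFr de) // eE set21.
have bN : b \notin nbr F v0 by rewrite (disjointFr de) // eE set22.
have wv : w != v0 by apply: contraNneq bN => <-.
have [sub|[dw dis]] := nbr_dichotomy d0 wv ltac:(by rewrite nbr_sym).
  by rewrite (subsetP sub) in bN.
have [->//|uv] := eqVneq u v0.
have [->//|uw] := eqVneq u w.
(* A neighbour [u] of [v0] has [v0] among its neighbours, and [v0] is not adjacent to [w]; this
   excludes inclusion in [nbr F w]. *)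
have [uNv|uNv] := boolP (u \in nbr F v0).
  have uNw : u \notin nbr F w by rewrite (disjointFl dis uNv).
  have [sub|[] //] := nbr_dichotomy dw uw ltac:(by rewrite nbr_sym).
  have := subsetP sub v0; rewrite nbr_sym uNv => /(_ isT).
  by rewrite nbr_sym (negbTE wN).
have [sub|[] //] := nbr_dichotomy d0 uv ltac:(by rewrite nbr_sym).
have wNu : w \notin nbr F u by apply: contra wN; apply/subsetP.
have [sub'|[] //] := nbr_dichotomy dw uw wNu.
have /set0Pn[x xu] := uN.
by have := disjointFr dis (subsetP sub' _ xu); rewrite (subsetP sub).
Qed.

Lemma cubic_nbr v0 u v : #|nbr F v0| = 3 -> nbr F u != set0 ->
  nbr F v != set0 -> u != v -> v \notin nbr F u ->
  nbr F u = nbr F v \/ [disjoint nbr F u & nbr F v].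
Proof.
move=> d0 uN vN uv nuv; have du := cubic d0 uN; have dv := cubic d0 vN.
have [sub|[_ ?]] := nbr_dichotomy dv uv nuv; [left|by right].
by apply/eqP; rewrite eqEcard sub du dv.
Qed.

(** A vertex [x] at distance two from [v] would have the same neighbourhood as [v]. Then the edges
    inside [nbr F v] would form a perfect matching on three vertices, which is impossible. *)
Lemma cubic_clique v a : #|nbr F v| = 3 -> a \in nbr F v ->
  nbr F a \subset v |: nbr F v.
Proof.
move=> dv aN; apply/subsetP => x xa; rewrite in_setU1.
have [->//|xv /=] := eqVneq x v; apply: contraT => xN.
have supp y z : y \in nbr F z -> nbr F y != set0.
  by rewrite nbr_sym => h; apply/set0Pn; exists z.
have vS : nbr F v != set0 by apply/set0Pn; exists a.
have nbrE y w : w \in nbr F v -> y \in nbr F w -> y != v -> y \notin nbr F v ->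
    nbr F y = nbr F v.
  move=> wN yw yv yN; have := cubic_nbr dv (supp _ _ yw) vS yv.
  rewrite nbr_sym yN => /(_ isT)[//|dis].
  by have := disjointFl dis wN; rewrite nbr_sym yw.
have xE : nbr F x = nbr F v := nbrE x a aN xa xv xN.
(* The third neighbour of [w], besides [v] and [x], lies in [nbr F v]: otherwise it would be a third
   vertex with neighbourhood [nbr F v]. *)
have inner w : w \in nbr F v -> exists2 w', w' \in nbr F w & w' \in nbr F v.
  move=> wN; have dw : #|nbr F w| = 3 by apply: cubic dv (supp _ _ wN).
  have [w' w'N /norP[w'v w'x]] : exists2 w', w' \in nbr F w & ~~ ((w' == v) || (w' == x)).
    apply/exists_inP; apply: contraT => /exists_inPn h.
    have : nbr F w \subset [set v; x].
      by apply/subsetP => y /h; rewrite negbK !inE.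
    by move/subset_leq_card; rewrite dw cards2; case: (v != x).
  exists w' => //; apply: contraT => w'Nv.
  have w'E := nbrE w' w wN w'N w'v w'Nv.
  have := kF (x := v) (y := x) (z := w').
  by rewrite xE w'E dv eq_sym xv (eq_sym v) w'v (eq_sym x) w'x eqxx => /(_ isT isT isT erefl erefl).
(* Two of the three neighbours of [w] are [v] and [x], which leaves room for only one inside
   [nbr F v]. *)
have uniq_inner w y z : w \in nbr F v -> y \in nbr F v -> z \in nbr F v ->
    y \in nbr F w -> z \in nbr F w -> y = z.
  move=> wN yN zN yw zw; apply/eqP; apply: contraT => yz.
  have vN := nbr_irr v sF.
  have : [set v; x; y; z] \subset nbr F w.
    apply/subsetP => k; rewrite !in_setU !in_set1 -!orbA.
    case/or4P => /eqP-> //; first by rewrite nbr_sym.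
    by rewrite nbr_sym xE.
  have -> : [set v; x; y; z] = v |: (x |: [set y; z]) by rewrite !setUA.
  move/subset_leq_card; have := dF w; rewrite !cardsU1 cards1.
  rewrite !in_setU1 !in_set1 (eq_sym v x) (negbTE xv) (negbTE yz).
  have -> : (v == y) = false by apply: contraNF vN => /eqP e; rewrite {1}e.
  have -> : (v == z) = false by apply: contraNF vN => /eqP e; rewrite {1}e.
  have -> : (x == y) = false by apply: contraNF xN => /eqP e; rewrite {1}e.
  have -> : (x == z) = false by apply: contraNF xN => /eqP e; rewrite {1}e.
  by move=> h1 h2; have := leq_trans h2 h1.
have [a' a'a a'N] := inner a aN.
have aa' : a != a' by apply: simple_neq a'a.
have [c cN /norP[ca ca']] : exists2 c, c \in nbr F v & ~~ ((c == a) || (c == a')).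
  apply/exists_inP; apply: contraT => /exists_inPn h.
  have : nbr F v \subset [set a; a'].
    by apply/subsetP => y /h; rewrite negbK !inE.
  by move/subset_leq_card; rewrite dv cards2; case: (a != a').
have [c' c'c c'N] := inner c cN.
have [c'a|c'a] := eqVneq c' a.
  have := uniq_inner a a' c aN a'N cN a'a; rewrite nbr_sym -c'a c'c => /(_ isT) e.
  by rewrite e eqxx in ca'.
have [c'a'|c'a'] := eqVneq c' a'.
  have := uniq_inner a' a c a'N aN cN; rewrite nbr_sym a'a nbr_sym -c'a' c'c.
  by move=> /(_ isT isT) e; rewrite e eqxx in ca.
have : [set a; a'; c; c'] \subset nbr F v.
  by apply/subsetP => k; rewrite !in_setU !in_set1 -!orbA => /or4P[]/eqP->.
have -> : [set a; a'; c; c'] = a |: (a' |: [set c; c']) by rewrite !setUA.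
move/subset_leq_card; rewrite dv !cardsU1 cards1 !in_setU1 !in_set1.
rewrite (negbTE aa') (eq_sym a c) (negbTE ca) (eq_sym a c') (negbTE c'a).
rewrite (eq_sym a' c) (negbTE ca') (eq_sym a' c') (negbTE c'a').
by rewrite (simple_neq sF c'c).
Qed.

(* All components would be copies of [K_4], but there are ten vertices. *)
Lemma no_cubic v0 : #|nbr F v0| != 3.
Proof.
apply/eqP => d0; pose S := [set v | nbr F v != set0].
pose X v := v |: nbr F v.
have cX v : v \in S -> #|X v| = 4.
  by rewrite inE => /(cubic d0) dv; rewrite cardsU1 nbr_irr // dv.
have XE v a : v \in S -> a \in X v -> X a = X v.
  move=> vS; rewrite in_setU1 => /orP[/eqP->//|aN].
  have dv : #|nbr F v| = 3 by apply: cubic d0 _; rewrite inE in vS.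
  have aS : a \in S by rewrite inE; apply/set0Pn; exists v; rewrite nbr_sym.
  apply/eqP; rewrite eqEcard !cX // andbT subUset sub1set in_setU1 aN orbT.
  exact: cubic_clique.
have cS : #|S| = 10.
  have := handshake sF; rewrite cF (bigID (mem S)) /=.
  rewrite [X in _ + X]big1 ?addn0 => [|v]; last first.
    by rewrite inE negbK => /eqP->; rewrite cards0.
  rewrite (eq_bigr (fun=> 3)) => [|v]; last by rewrite inE => /(cubic d0).
  rewrite sum_nat_const; lia.
have pS : partition [set X v | v in S] S.
  apply/and3P; split.
  - rewrite cover_imset; apply/eqP/setP => x; apply/bigcupP/idP => [[v vS]|xS].
      rewrite in_setU1 => /orP[/eqP->//|xv].
      by rewrite inE; apply/set0Pn; exists v; rewrite nbr_sym.
    by exists x; rewrite // setU11.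
  - apply/trivIsetP => _ _ /imsetP[v vS ->] /imsetP[w wS ->].
    apply: contraNT => /pred0Pn[x /= /andP[xv xw]].
    by rewrite -(XE v x vS xv) (XE w x wS xw).
  - by apply/imsetP => -[v vS] /esym e; have := cX v vS; rewrite e cards0.
have := card_uniform_partition (n := 4) _ pS; rewrite cS.
suff h : {in [set X v | v in S], forall A : {set T}, #|A| = 4} by move=> /(_ h); lia.
by move=> _ /imsetP[v vS ->]; apply: cX.
Qed.

End Cubic.
End Configurations.

(** * Abstract symmetric tensor matroids *)

Lemma exists_subset_card (T : finType) (A : {set T}) m : m <= #|A| ->
  exists2 B : {set T}, B \subset A & #|B| = m.
Proof.
move=> lem; exists [set x in take m (enum A)].
  by apply/subsetP => x; rewrite inE => /mem_take; rewrite mem_enum.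
rewrite cardsE; have /card_uniqP -> := take_uniq m (enum_uniq A).
by rewrite size_take_min -cardE; lia.
Qed.

Lemma binS2 m : 'C(m.+1, 2) = 'C(m, 2) + m.
Proof. by rewrite binS bin1. Qed.

Section TensorMatroid.
Variables (n t : nat) (M : matroid (complete_edges n)).
Hypothesis hn : t.+1 <= n.
Hypothesis circuit_star : forall v (L : {set 'I_n}), v \notin L ->
  #|L| = t.+1 -> circuit M (star v L).
Implicit Types (X Y : {set 'I_n}) (A F : {set {set 'I_n}}).

Definition inc X : {set {set 'I_n}} :=
  [set e in complete_edges n | ~~ [disjoint e & X]].

Lemma in_edges (v w : 'I_n) : ([set v; w] \in complete_edges n) = (v != w).
Proof. by rewrite inE cards2; case: (v != w). Qed.

Lemma in_inc X (v w : 'I_n) :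
  ([set v; w] \in inc X) = (v != w) && ((v \in X) || (w \in X)).
Proof.
rewrite inE in_edges; congr (_ && _); apply/pred0Pn/orP => [[x /= /andP[]]|].
  by rewrite in_set2 => /orP[]/eqP-> ?; [left|right].
by case=> h; [exists v|exists w]; rewrite /= in_set2 eqxx ?orbT.
Qed.

Lemma incS X Y : X \subset Y -> inc X \subset inc Y.
Proof.
move=> sXY; apply/subsetP => e; rewrite !inE => /andP[-> /pred0Pn[x /= /andP[xe xX]]].
by apply/pred0Pn; exists x; rewrite /= xe (subsetP sXY).
Qed.

Lemma inc_sub X : inc X \subset complete_edges n.
Proof. by apply/subsetP => e /setIdP[]. Qed.

Lemma card_star v (L : {set 'I_n}) : #|star v L| = #|L|.
Proof. exact/card_imset/set2_inj. Qed.

(** Any [t] edges at [v] are independent, and any further edge at [v] closes a circuit with them, so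
    they span the whole star of [v]. *)
Lemma star_spans v (L : {set 'I_n}) w (A : {set {set 'I_n}}) :
  v \notin L -> #|L| = t -> star v L \subset A -> w != v ->
  rank M ([set v; w] |: A) = rank M A.
Proof.
move=> vL cL sLA wv; apply: rankU1_mono sLA.
have [wL|wL] := boolP (w \in L).
  by rewrite (setUidPr _) // sub1set in_star eqxx wL.
have eS : [set v; w] |: star v L = star v (w |: L).
  by rewrite /star imsetU1.
have := circuit_star (v := v) (L := w |: L).
rewrite in_setU1 negb_or eq_sym wv vL cardsU1 wL cL => /(_ isT erefl).
case/minsetP=> /andP[sE dep] hmin.
have iL : star v L \in indep M.
  apply: contraT => nL; have sLw : star v L \subset star v (w |: L).
    by rewrite -eS subsetUr.
  have := hmin _ _ sLw; rewrite inE (subset_trans sLw sE) nL => /(_ isT)/(congr1 (fun A => #|pred_of_set A|)).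
  by rewrite !card_star cardsU1 wL => /eqP; rewrite -[X in X == _]add0n eqn_add2r.
apply/eqP; rewrite eqn_leq [X in _ && X]rankS ?subsetUr // andbT.
rewrite (rank_indep iL) eS -ltnS.
have : rank M (star v (w |: L)) != #|star v (w |: L)|.
  by apply: contra dep => /eqP/indep_rank.
have := rank_leq_card M (star v (w |: L)).
by rewrite !card_star cardsU1 wL; lia.
Qed.

(** Vertices are added one at a time. A vertex joined to [j] earlier ones needs only [t - j] further
    edges before its star is spanned. *)
Lemma rank_inc X : #|X| <= t ->
  rank M (inc X) + 'C(t.+1 - #|X|, 2) <= 'C(t.+1, 2).
Proof.
have [k] := ubnP #|X|; elim: k X => // k IH X ltk lt.
have [->|[v vX]] := set_0Vmem X.
  rewrite cards0 subn0 -[leqRHS]add0n leq_add2r.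
  have -> : inc set0 = set0.
    apply/setP => e; rewrite !inE andbC; apply/negbTE; rewrite negb_and negbK.
    by rewrite disjoints_subset setC0 subsetT.
  by have := rank_leq_card M set0; rewrite cards0.
have cX : #|X| = #|X :\ v|.+1 by rewrite (cardsD1 v) vX.
have {}IH : rank M (inc (X :\ v)) + 'C(t.+1 - #|X :\ v|, 2) <= 'C(t.+1, 2).
  by apply: IH; lia.
(* The edges from [v] to [X :\ v] are already present; [W] supplies the ends of the missing ones, up
   to [t] edges at [v]. *)
have [W sW cW] : exists2 W : {set 'I_n}, W \subset ~: X & #|W| = t - #|X :\ v|.
  by apply: exists_subset_card; have := cardsC X; rewrite card_ord; lia.
have vW : v \notin W by apply: contraL vX => /(subsetP sW); rewrite inE.
have dW : [disjoint X :\ v & W].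
  rewrite disjoint_sym disjoints_subset; apply: subset_trans sW _.
  by rewrite setCS subsetDl.
pose A := inc (X :\ v) :|: star v W.
have : rank M (inc X) <= rank M (A :|: inc [set v]).
  apply: rankS; apply/subsetP => e; rewrite !inE => /andP[-> /pred0Pn[x /= /andP[xe xX]]] /=.
  have [xv|xv] := eqVneq x v.
    apply/orP; right; apply/pred0Pn; exists v.
    by rewrite /= -xv xe in_set1 eqxx.
  apply/orP; left; apply/orP; left; apply/pred0Pn; exists x.
  by rewrite /= xe in_setD1 xv.
have -> : rank M (A :|: inc [set v]) = rank M A.
  apply: rankU_id => e eI; have := subsetP (inc_sub [set v]) e eI.
  rewrite inE => /cards2P[x [y [xy eE]]].
  have [w [wv ->]] : exists w, w != v /\ e = [set v; w].
    move: eI; rewrite eE in_inc !in_set1 => /andP[_ /orP[]/eqP h]; subst.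
      by exists y; rewrite eq_sym xy.
    by exists x; rewrite xy setUC.
  apply: (@star_spans v (X :\ v :|: W)) => //.
  - by rewrite in_setU in_setD1 eqxx (negbTE vW).
  - by rewrite cardsU (disjoint_setI0 dW) cards0 cW; lia.
  apply/subsetP => _ /imsetP[z zW ->]; rewrite in_setU in_inc in_star eqxx /=.
  move: zW; rewrite in_setU => /orP[zX|->]; last by rewrite orbT.
  by have /setD1P[zv _] := zX; rewrite zX orbT eq_sym zv.
have := rankU_leq M (inc (X :\ v)) (star v W); rewrite card_star cW -/A.
have : t.+1 - #|X :\ v| = (t.+1 - #|X|).+1 by lia.
move=> eC; rewrite eC binS2 in IH; lia.
Qed.

(** A vertex outside [X] is joined to all [t] vertices of [X], so its star is spanned. *)
Lemma rank_inc_full X : #|X| = t -> rank M (inc X) = rank M (complete_edges n).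
Proof.
move=> cX.
suff h : rank M (inc X :|: complete_edges n) = rank M (inc X).
  by rewrite -h (setUidPr (inc_sub X)).
apply: rankU_id => e eE.
have [eI|eI] := boolP (e \in inc X); first by rewrite (setUidPr _) // sub1set.
move: (eE) eI; rewrite inE => /cards2P[x [y [xy ->]]].
rewrite in_inc xy negb_or => /andP[xX yX].
apply: (@star_spans x X) => //; last by rewrite eq_sym.
apply/subsetP => _ /imsetP[z zX ->]; rewrite in_inc zX orbT andbT.
by apply: contraNneq xX => ->.
Qed.

Lemma rank_tensor_leq A : A \subset complete_edges n -> rank M A <= 'C(t.+1, 2).
Proof.
move=> sA; have [X sX cX] : exists2 X : {set 'I_n}, X \subset setT & #|X| = t.
  by apply: exists_subset_card; rewrite cardsT card_ord ltnW.
apply: leq_trans (rankS M sA) _; rewrite -(rank_inc_full cX).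
by have := @rank_inc X; rewrite cX leqnn => /(_ isT); apply/leq_trans/leq_addr.
Qed.

(* [F] spans the contraction of [M] by all edges that meet [X]. *)
Definition spans X F : bool := 'C(t.+1, 2) <= rank M (F :|: inc X).

Lemma spans_del X F v : simple F -> spans X F -> spans (v |: X) (del F v).
Proof.
move=> sF /leq_trans; apply; apply: rankS; rewrite subUset; apply/andP; split.
  apply/subsetP => e eF; rewrite in_setU inE eF /=.
  have := subsetP sF _ eF; rewrite inE => ce.
  case ve : (v \in e) => //=; rewrite inE inE ce /=.
  by apply/pred0Pn; exists v; rewrite /= ve setU11.
by apply: subset_trans (subsetUr _ _); apply/incS/subsetUr.
Qed.

(** After [v] is moved into [X], the edges of [F] that remain must still make up the rank that
    [rank_inc] leaves missing, namely ['C(s.+1, 2)]. *)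
Lemma spans_deg_leq X F s v : simple F -> #|X| + s.+1 = t -> v \notin X ->
  #|F| = 'C(s.+2, 2) -> spans X F -> #|nbr F v| <= s.+1.
Proof.
move=> sF cX vX cF /(spans_del v sF); rewrite /spans => h.
have := rankU_leq M (inc (v |: X)) (del F v); rewrite setUC.
have := rank_inc (X := v |: X); rewrite cardsU1 vX.
have -> : t.+1 - (true + #|X|) = s.+1 by lia.
have := card_del v sF; rewrite cF binS2; lia.
Qed.

(* If no such edge existed, the edges meeting [nbr F v :|: X] would span the
   star of [v]; but only [t.-1] vertices cannot span. *)
Lemma spans_del_edge X F s v : simple F -> #|X| + s.+1 = t ->
  v \notin X -> {in F, forall e : {set 'I_n}, [disjoint e & X]} -> #|nbr F v| = s ->
  rank M (complete_edges n) = 'C(t.+1, 2) -> spans X F ->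
  exists e, [/\ e \in del F v, [disjoint e & nbr F v]
              & spans (v |: X) (del F v :\ e)].
Proof.
move=> sF cX vX dX dv rE sp.
set N := nbr F v; set G := del F v; set Y := v |: X.
pose H := [set e in G | [disjoint e & N]].
have [e /andP[eH spe]|none] := pickP [pred e in H | spans Y (G :\ e)].
  by exists e; move: eH; rewrite inE => /andP[].
exfalso.
have sHG : H \subset G by apply/subsetP => e; rewrite inE => /andP[].
have sHF : H \subset F by apply: subset_trans sHG (del_sub _ _).
have sFE : F \subset complete_edges n by [].
(* When no edge of [H] works, all of them are coloops of [G] modulo [inc Y], and the rest of [G]
   falls short of full rank by at least [#|H|]. *)
have rG : rank M (inc Y :|: (G :\: H)) + #|H| <= 'C(t.+1, 2).
  have hH : G :\: (G :\: H) = H by rewrite setDDr setDv set0U (setIidPr sHG).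
  have := @rank_coloops _ _ M (inc Y) G (G :\: H) (subsetDl _ _); rewrite hH.
  move=> hc; apply: leq_trans (hc _) _ => [e eH|].
    have := none e; rewrite inE eH /spans /= => /negbT; rewrite -ltnNge setUC.
    move/leq_trans; apply; rewrite setUC; exact: spans_del.
  apply: rank_tensor_leq; rewrite subUset inc_sub.
  exact: subset_trans (del_sub _ _) sFE.
(* Dropping [H] from [F] costs at most [#|H|]. With [rG] this makes [inc X :|: (F :\: H)] span
   [inc Y :|: (G :\: H)], and in particular the star of [v]. *)
have rD : 'C(t.+1, 2) <= rank M (inc X :|: (F :\: H)) + #|H|.
  apply: leq_trans sp _; apply: leq_trans (rankU_leq _ _ _); apply: rankS.
  by rewrite -setUA setUC setUS // -{1}(setID F H) setUC setUS // subsetIr.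
have sDY : inc X :|: (F :\: H) \subset inc Y :|: (G :\: H).
  rewrite subUset (subset_trans (incS (subsetUr _ _)) (subsetUl _ _)) /=.
  apply/subsetP => e; rewrite in_setD => /andP[eH eF].
  rewrite in_setU in_setD eH [e \in G]inE eF /=.
  case ve: (v \in e); rewrite ?orbT ?orbF //=.
  rewrite inE (subsetP sFE _ eF) /=.
  by apply/pred0Pn; exists v; rewrite /= ve setU11.
have sDN : inc X :|: (F :\: H) \subset inc (N :|: X).
  rewrite subUset incS ?subsetUr //=.
  apply/subsetP => e /setDP[eF eH]; rewrite inE (subsetP sFE _ eF) /=.
  case ve: (v \in e).
    have [w wN ->] := edge_nbr sF eF ve; apply/pred0Pn; exists w.
    by rewrite /= in_set2 eqxx orbT in_setU wN.
  move: eH; rewrite !inE eF ve /= => /pred0Pn[x /= /andP[xe xN]].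
  by apply/pred0Pn; exists x; rewrite /= xe in_setU xN.
have dNX : [disjoint N & X].
  rewrite disjoints_subset; apply/subsetP => w; rewrite inE => /dX.
  rewrite disjoints_subset => /subsetP/(_ w); rewrite set22; exact.
have cNX : #|N :|: X| = s + #|X| by rewrite cardsU (disjoint_setI0 dNX) cards0 subn0 dv.
have vNX : v \notin N :|: X by rewrite in_setU negb_or vX nbr_irr.
have full : rank M (inc (v |: (N :|: X))) = 'C(t.+1, 2).
  by rewrite rank_inc_full // cardsU1 vNX cNX; clear -cX; lia.
have sub : inc (v |: (N :|: X)) \subset inc (N :|: X) :|: inc [set v].
  apply/subsetP => e; rewrite !inE => /andP[-> /pred0Pn[x /= /andP[xe]]].
  rewrite /= in_setU1 => /orP[/eqP xv|xN]; apply/orP; [right|left];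
    by apply/pred0Pn; exists x; rewrite /= xe ?in_set1 ?xv ?eqxx.
have : rank M (inc (N :|: X) :|: inc [set v]) = rank M (inc (N :|: X)).
  apply: rankU_id => e eI; apply: rankU1_mono sDN.
  apply/eqP; rewrite eqn_leq [X in _ && X]rankS ?subsetUr // andbT.
  apply: leq_trans (_ : rank M (inc Y :|: (G :\: H)) <= _); last first.
    by rewrite -(leq_add2r #|H|) (leq_trans rG rD).
  apply: rankS; rewrite subUset sDY sub1set in_setU andbT.
  by rewrite (subsetP (incS _) _ eI) // sub1set setU11.
have := rankS M sub; rewrite full => + eqr; rewrite eqr.
have := rank_inc (X := N :|: X); rewrite cNX.
have [-> ->] : t.+1 - (s + #|X|) = 2 /\ s + #|X| <= t by clear -cX; split; lia.
rewrite binn addn1 => /(_ isT) h1 h2.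
by have := leq_trans h1 h2; rewrite ltnn.
Qed.

End TensorMatroid.

(** * Generic points *)

Import Order.TTheory GRing.Theory Num.Theory.
Local Open Scope ring_scope.

(** The dual form of the statement that the vectors [g i] span ['rV_m]. *)
Definition separating (K : fieldType) m (I : finType) (g : I -> 'rV[K]_m) :=
  forall w : 'rV_m, (forall i, w *m (g i)^T = 0) -> w = 0.

Definition family_mx (K : nzRingType) m (I : finType) (g : I -> 'rV[K]_m) :=
  \matrix_(k < m, i < #|I|) g (enum_val i) 0 k.

Lemma mul_family_mx (K : fieldType) m (I : finType) (g : I -> 'rV[K]_m)
    (w : 'rV_m) i :
  (w *m family_mx g) 0 i = (w *m (g (enum_val i))^T) 0 0.
Proof. by rewrite !mxE; apply: eq_bigr => j _; rewrite !mxE. Qed.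

Lemma separatingE (K : fieldType) m (I : finType) (g : I -> 'rV[K]_m) :
  separating g <-> row_free (family_mx g).
Proof.
split=> [sg | fg w hw].
  rewrite -kermx_eq0; apply/eqP/row_matrixP => k; rewrite row0; apply: sg => i.
  apply/matrixP => a b; rewrite !ord1 -{1}(enum_rankK i) -mul_family_mx.
  by rewrite -row_mul mulmx_ker row0 !mxE.
apply/eqP; rewrite -(mulmx_free_eq0 _ fg); apply/eqP/rowP => i.
by rewrite mul_family_mx hw !mxE.
Qed.

Lemma row_freeT (K : fieldType) m k (A : 'M[K]_(m, k)) :
  row_free A = row_full A^T.
Proof. by rewrite /row_free /row_full mxrank_tr. Qed.

Lemma exists_nonroot (K : numDomainType) (p : {poly K}) : p != 0 ->
  exists x, ~~ root p x.
Proof.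
move=> p0; pose rs := [seq (k%:R : K) | k <- iota 0 (size p)].
have [allr|] := boolP (all (root p) rs).
  have := max_poly_roots p0 allr; rewrite size_map size_iota ltnn.
  case/(_ _)/negP => //; first by rewrite map_inj_uniq ?iota_uniq //;
    move=> i j /eqP; rewrite eqr_nat => /eqP.
by case/allPn => x _; exists x.
Qed.

(** With [C] a right inverse of the matrix of [g], a vector annihilating the perturbed family is an
    eigenvector of [D] for [eps^-1]; so [eps^-1] is chosen nonzero and off the roots of the
    characteristic polynomial. *)
Lemma separating_perturb (K : numFieldType) m (I : finType)
    (g h : I -> 'rV[K]_m) : separating g ->
  exists2 eps, eps != 0 & separating (fun i => g i + eps *: h i).
Proof.
move=> /separatingE/row_freeP[C gC].
pose D := - (family_mx h *m C).
have pD : char_poly D * 'X != 0.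
  by rewrite mulf_neq0 ?polyX_eq0 // monic_neq0 // char_poly_monic.
have [x] := exists_nonroot pD; rewrite rootM negb_or rootX => /andP[rx x0].
exists x^-1; first by rewrite invr_eq0.
move=> w hw; apply/eqP; apply: contraNT rx => w0.
rewrite -eigenvalue_root_char; apply/eigenvalueP; exists w => //.
have : w *m (family_mx g + x^-1 *: family_mx h) = 0.
  have -> : family_mx g + x^-1 *: family_mx h =
            family_mx (fun i => g i + x^-1 *: h i).
    by apply/matrixP => a b; rewrite !mxE.
  by apply/rowP => i; rewrite mul_family_mx hw !mxE.
move/(congr1 (fun A => A *m C)); rewrite -mulmxA mulmxDl gC -scalemxAl mul0mx.
rewrite mulmxDr mulmx1 -scalemxAr => /eqP; rewrite addr_eq0 => /eqP wE.
by rewrite [in RHS]wE scalerN scalerA divff // scale1r mulmxN.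
Qed.

Section Transfer.
Variables (R : realType) (N m : nat) (I : finType).
Variable G : I -> 'rV[{mpoly rat[N]}]_m.

Let ev (x : 'I_N -> R) : {mpoly rat[N]} -> R := mmap ratr x.

(** Some maximal minor is nonzero at [y]. It is the value of a nonzero polynomial with rational
    coefficients, which cannot vanish at the algebraically independent [x]. *)
Lemma separating_generic (x y : 'I_N -> R) : alg_independent x ->
  separating (fun i => map_mx (ev y) (G i)) ->
  separating (fun i => map_mx (ev x) (G i)).
Proof.
move=> ax /separatingE; have famE z :
  family_mx (fun i => map_mx (ev z) (G i)) = map_mx (ev z) (family_mx G).
  by apply/matrixP => a b; rewrite !mxE.
rewrite famE row_freeT map_trmx => fy; apply/separatingE; rewrite famE row_freeT map_trmx.
pose f := fullrankfun fy.
have := fullrowsub_unit fy; rewrite -map_mxsub unitmxE det_map_mx.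
rewrite unitfE => dy.
have : rowsub f (map_mx (ev x) (family_mx G)^T) \in unitmx.
  rewrite -map_mxsub unitmxE det_map_mx unitfE; apply: contra dy => /eqP/ax ->.
  by rewrite rmorph0.
rewrite -row_full_unit -sub1mx => h; rewrite -sub1mx.
exact: submx_trans h (rowsub_sub _ _).
Qed.

End Transfer.

(** * Tensors of edges at generic and at special placements *)

Section Spanning.
Variables (K : nzRingType) (n s : nat).
Implicit Types (q : 'I_n -> 'rV[K]_s) (F : {set {set 'I_n}}).

(* When [F] is simple, this says that the tensors of the edges of [F] span the
   symmetric matrices. *)
Definition spanning_tensors q F := forall W : 'M[K]_s, W^T = W ->
  (forall a b, [set a; b] \in F -> q a *m W *m (q b)^T = 0) -> W = 0.

(** The skew members vanish on [W] exactly when [W] is symmetric, so separation among all matrices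
    tests only symmetric ones. *)
Definition tensor_family q F (i : 'I_n * 'I_n + 'I_s * 'I_s) : 'rV[K]_(s * s) :=
  match i with
  | inl (a, b) => if [set a; b] \in F then mxvec ((q a)^T *m q b) else 0
  | inr (i, j) => mxvec (delta_mx i j - delta_mx j i)
  end.

End Spanning.

Section Form.
Variables (K : fieldType) (s : nat).
Implicit Types (W : 'M[K]_s) (x y : 'rV[K]_s).

Lemma trmx11 (A : 'M[K]_1) : A^T = A.
Proof. by apply/matrixP => i j; rewrite !ord1 mxE. Qed.

Lemma form_sym W x y : W^T = W -> x *m W *m y^T = y *m W *m x^T.
Proof. by move=> sW; rewrite -[LHS]trmx11 trmx_mul trmxK trmx_mul sW mulmxA. Qed.

Lemma mxvec_form W x y : mxvec W *m (mxvec (x^T *m y))^T = x *m W *m y^T.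
Proof. by rewrite -mxvec_dotmul -[LHS]trmx11 trmx_mul trmxK. Qed.

Lemma mxvec_skew W i j :
  mxvec W *m (mxvec (delta_mx i j - delta_mx j i))^T = (W i j - W j i)%:M.
Proof.
have dE k l : delta_mx k l = (delta_mx (0 : 'I_1) k)^T *m delta_mx 0 l :> 'M[K]_s.
  by rewrite trmx_delta mul_delta_mx.
have eE k l : mxvec W *m (mxvec (delta_mx k l))^T = (W k l)%:M.
  rewrite dE mxvec_form -rowE trmx_delta -colE.
  by apply/matrixP => a b; rewrite !ord1 !mxE mulr1n.
by rewrite !linearB /= !eE -raddfB.
Qed.

End Form.

Lemma spanning_separating (K : fieldType) n s (q : 'I_n -> 'rV[K]_s) F :
  spanning_tensors q F <-> separating (tensor_family q F).
Proof.
split=> [sp w hw | sep W sW hW].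
  rewrite -(vec_mxK w) in hw *; move: (vec_mx w) hw => W hW.
  apply/eqP; rewrite mxvec_eq0; apply/eqP; apply: sp => [|a b abF].
    apply/matrixP => i j; rewrite mxE; have := hW (inr (j, i)).
    by rewrite /= mxvec_skew => /(congr1 (fun A : 'M_1 => A 0 0)); rewrite !mxE mulr1n
      => /subr0_eq.
  by have := hW (inl (a, b)); rewrite /= abF mxvec_form.
apply/eqP; rewrite -mxvec_eq0; apply/eqP; apply: sep => -[[a b]|[i j]] /=.
  by case: ifP => [abF|_]; rewrite ?mxvec_form ?hW // trmx0 mulmx0.
by rewrite mxvec_skew -{1}sW mxE subrr; apply/matrixP => a b; rewrite !mxE mul0rn.
Qed.

Section Coordinates.
Variables (n t : nat).

(* The coordinates beyond [t] are zero. *)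
Definition coord_point (K : nzRingType) s (y : 'I_(n * t) -> K) (a : 'I_n) :
    'rV[K]_s :=
  \row_(j < s) oapp (fun k => y (mxvec_index a k)) 0 (insub (j : nat) : option 'I_t).

Lemma map_coord_point (K L : nzRingType) (f : {rmorphism K -> L}) s y a :
  map_mx f (coord_point s y a) = coord_point s (f \o y) a.
Proof.
by apply/rowP => j; rewrite !mxE; case: insub => //=; rewrite rmorph0.
Qed.

Lemma coord_point_surj (K : nzRingType) s (q : 'I_n -> 'rV[K]_s) : (s <= t)%N ->
  exists y, coord_point s y =1 q.
Proof.
move=> le_st.
pose Q := \matrix_(a < n, k < t) oapp (fun j => q a 0 j) 0
  (insub (k : nat) : option 'I_s).
exists (fun k => mxvec Q 0 k) => a; apply/rowP => j; rewrite mxE.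
have jt : (j < t)%N by apply: leq_trans le_st.
rewrite (insubT (fun k => (k < t)%N) jt) /= mxvecE mxE /= (insubT (fun k => (k < s)%N) (ltn_ord j)) /=.
by congr (q a 0 _); apply: val_inj.
Qed.

End Coordinates.

Section Generic.
Variables (R : realType) (n t : nat) (p : 'M[R]_(n, t)).
Hypothesis gp : generic p.

(** For [s <= t] this keeps the first [s] coordinates of [p], so a single placement serves every
    dimension of the induction. *)
Definition generic_point s : 'I_n -> 'rV[R]_s :=
  coord_point s (fun k => mxvec p 0 k).

Lemma generic_pointE a : generic_point t a = row a p.
Proof.
apply/rowP => j; rewrite !mxE; have jt := ltn_ord j.
by rewrite (insubT (fun k => (k < t)%N) jt) /= mxvecE; congr (p a _); apply: val_inj.
Qed.

Let var_point s : 'I_n -> 'rV[{mpoly rat[n * t]}]_s :=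
  coord_point s (fun k => 'X_k)%R.

Let ev (y : 'I_(n * t) -> R) : {mpoly rat[n * t]} -> R := mmap ratr y.

Lemma map_var_point y s a : map_mx (ev y) (var_point s a) = coord_point s y a.
Proof.
rewrite /ev map_coord_point; apply/rowP => j; rewrite !mxE.
by case: insub => //= k; rewrite mmapX mmap1U.
Qed.

Definition generic_spanning s F := spanning_tensors (generic_point s) F.

(** One special placement suffices: the entries of the tensors are polynomials in the coordinates of
    the points, so full rank transfers to the generic placement. *)
Lemma spanning_generic s F (q : 'I_n -> 'rV[R]_s) : (s <= t)%N ->
  spanning_tensors q F -> generic_spanning s F.
Proof.
move=> le_st sq; have [y yq] := coord_point_surj q le_st.
have famE z i : map_mx (ev z) (tensor_family (var_point s) F i) =
    tensor_family (coord_point s z) F i.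
  case: i => [[a b]|[i j]] /=.
    case: ifP => _; last by rewrite map_mx0.
    by rewrite map_mxvec map_mxM -map_trmx !map_var_point.
  by rewrite map_mxvec map_mxB !map_delta_mx.
apply/spanning_separating => w hw.
apply: (separating_generic (x := fun k => mxvec p 0 k) (y := y)
  (G := tensor_family (var_point s) F)) => // [v hv|i]; last by rewrite famE.
have /spanning_separating sep : spanning_tensors (coord_point s y) F.
  by move=> W sW hW; apply: sq => // a b; rewrite -!yq; apply: hW.
by apply: sep => i; have := hv i; rewrite famE.
Qed.

Lemma generic_independent s (A : {set 'I_n}) (w : 'rV_s) : (s <= t)%N -> (s <= #|A|)%N ->
  {in A, forall a, w *m (generic_point s a)^T = 0} -> w = 0.
Proof.
move=> le_st le_sA hw.
(* The special placement sends the first [s] elements of [A] to the unit vectors and all other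
   vertices to zero. *)
pose q (a : 'I_n) : 'rV[R]_s := \row_j (index a (enum A) == j)%:R.
have [y yq] := coord_point_surj q le_st.
pose G a := if a \in A then var_point s a else 0.
have GE z a : map_mx (ev z) (G a) = if a \in A then coord_point s z a else 0.
  by rewrite /G; case: ifP; rewrite ?map_mx0 ?map_var_point.
apply: (separating_generic (x := fun k => mxvec p 0 k) (y := y) (G := G)) => //.
  move=> v hv; apply/rowP => j.
  have jA : (j < size (enum A))%N by rewrite -cardE; apply: leq_trans le_sA.
  have [a [aA aj]] : exists a, a \in A /\ index a (enum A) = j.
    have [a _] : exists a, a \in A.
      apply/card_gt0P; apply: leq_trans le_sA; exact: leq_ltn_trans (ltn_ord j).
    exists (nth a (enum A) j); rewrite -mem_enum mem_nth // index_uniq //.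
    exact: enum_uniq.
  have := hv a; rewrite GE aA yq => /(congr1 (fun A : 'M_1 => A 0 0)); rewrite !mxE.
  rewrite (bigD1 j) //= !mxE aj eqxx mulr1 big1 ?addr0 // => k kj.
  by rewrite !mxE aj eq_sym -val_eqE in kj *; rewrite (negbTE kj) mulr0.
move=> a; rewrite GE; case: ifP => [aA|_]; last by rewrite trmx0 mulmx0.
exact: hw.
Qed.

End Generic.

(** * Moves that preserve spanning *)

Section Moves.
Variables (R : realType) (n t : nat) (p : 'M[R]_(n, t)).
Hypothesis gp : generic p.
Implicit Types F : {set {set 'I_n}}.

(* Place [v] on a new axis and let only the ends of [e] leave the old space:
   the edges at [N] kill the off-diagonal block of [W], the edges other than [e]
   its old block, and [e] the remaining diagonal entry. *)
Lemma spanning_extend s F v e (N : {set 'I_n}) : simple F -> (s < t)%N ->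
  N \subset nbr F v -> (s <= #|N|)%N -> e \in F -> [disjoint e & N] ->
  generic_spanning p s (del F v :\ e) -> generic_spanning p s.+1 F.
Proof.
move=> sF lt_st sN cN eF dN spF.
pose c a : R := ((a == v) || (a \in e))%:R.
pose x a := if a == v then 0 else generic_point p s a.
pose q a : 'rV[R]_(1 + s) := row_mx (c a)%:M (x a).
apply: (spanning_generic gp (q := q)) => // W sW hW.
set z := ulsubmx (W : 'M_(1 + s)); set y := ursubmx (W : 'M_(1 + s)).
set W' := drsubmx (W : 'M_(1 + s)).
have WE : W = block_mx z y y^T W' by rewrite trmx_ursub sW submxK.
have formE a b : q a *m W *m (q b)^T =
    (c a)%:M *m z *m (c b)%:M + x a *m y^T *m (c b)%:M
    + ((c a)%:M *m y *m (x b)^T + x a *m W' *m (x b)^T).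
  rewrite /q WE mul_row_block tr_row_mx mul_row_col tr_scalar_mx.
  by rewrite !mulmxDl.
have Nv w : w \in N -> (w == v) = false.
  move=> /(subsetP sN) /(simple_neq sF); rewrite eq_sym; exact: negbTE.
have y0 : y = 0.
  apply: (generic_independent gp (A := N)) => //; first exact: ltnW.
  move=> w wN; have := hW v w; rewrite -in_nbr (subsetP sN) // formE.
  have -> : c w = 0.
    rewrite /c Nv //=; have := disjointFl dN wN; by move->.
  have -> : x v = 0 by rewrite /x eqxx.
  have -> : c v = 1 by rewrite /c eqxx.
  rewrite /x Nv // !raddf0 ?mulmx0 ?mul0mx mul1mx ?add0r ?addr0.
  exact.
have {}formE a b : q a *m W *m (q b)^T = (c a * c b) *: z + x a *m W' *m (x b)^T.
  rewrite formE y0 !trmx0 !mulmx0 !mul0mx addr0 add0r.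
  by rewrite scalar_mxC !mul_scalar_mx scalerA [c b * _]mulrC.
have W'0 : W' = 0.
  apply: spF => [|a b]; first by rewrite trmx_drsub sW.
  rewrite in_setD1 => /andP[ne]; rewrite inE in_set2 negb_or => /and3P[abF va vb].
  have := hW a b abF; rewrite formE /x ![_ == v]eq_sym (negbTE va) (negbTE vb).
  suff -> : c a * c b = 0 by rewrite scale0r add0r.
  rewrite /c ![_ == v]eq_sym (negbTE va) (negbTE vb) /=.
  have [ae|_] := boolP (a \in e); last by rewrite mul0r.
  have [be|_] := boolP (b \in e); last by rewrite mulr0.
  case/negP: ne; apply/eqP; apply/eqP; rewrite eqEcard subUset !sub1set ae be /=.
  have := subsetP sF e eF; have := subsetP sF _ abF.
  by rewrite !inE => /eqP-> /eqP->.
have z0 : z = 0.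
  have [a [b [_ eE]]] := simpleP sF eF; have := hW a b; rewrite -eE formE W'0.
  rewrite mulmx0 mul0mx addr0 /c eE !set21 set22 !orbT mulr1 scale1r.
  by rewrite -eE; apply.
by rewrite WE z0 y0 W'0 trmx0; apply/matrixP => i j; rewrite !mxE;
  case: split => k; rewrite mxE; case: split => l; rewrite mxE.
Qed.

(** An edge at [v] itself serves as [e], and the other [s] neighbours serve as [N]. *)
Lemma spanning_0ext s F v : simple F -> (s < t)%N -> #|nbr F v| = s.+1 ->
  generic_spanning p s (del F v) -> generic_spanning p s.+1 F.
Proof.
move=> sF lt_st dv; have [w wN] : exists w, w \in nbr F v.
  by apply/card_gt0P; rewrite dv.
move=> h; apply: (@spanning_extend s F v [set v; w] (nbr F v :\ w)) => //.
- exact: subsetDl.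
- by have := cardsD1 w (nbr F v); rewrite wN dv; lia.
- by rewrite -in_nbr.
- rewrite disjoints_subset; apply/subsetP => x; rewrite in_setC in_set2 in_setD1.
  by case/orP => /eqP->; rewrite ?eqxx // negb_and nbr_irr ?orbT.
suff -> : del F v :\ [set v; w] = del F v by [].
by apply/setDidPl; rewrite disjoint_sym disjoints1 inE set21 andbF.
Qed.

Lemma spanning_1ext s F v e : simple F -> (s < t)%N -> #|nbr F v| = s ->
  e \in F -> [disjoint e & nbr F v] ->
  generic_spanning p s (del F v :\ e) -> generic_spanning p s.+1 F.
Proof. by move=> sF lt_st dv eF dN; apply: (@spanning_extend s F v e (nbr F v)); rewrite ?dv. Qed.

(* Move [p_u] to [p_v + eps p_u]. *)
Lemma spanning_compress s F u v : simple F -> u != v -> v \notin nbr F u ->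
  (s <= t)%N -> generic_spanning p s (compress F u v) -> generic_spanning p s F.
Proof.
move=> sF uv nuv le_st /spanning_separating sep.
set P := generic_point p s in sep *.
(* These are the edges [vb] of the compression that replace an edge [ub]. Perturbing the tensor of
   [vb] by [eps] times that of [ub] gives the tensor of [ub] at the new position of [u]. *)
pose moved a b := (a == v) && (b \in nbr F u :\: nbr F v).
pose h (i : 'I_n * 'I_n + 'I_s * 'I_s) : 'rV[R]_(s * s) := match i with
  | inl (a, b) => if moved a b then mxvec ((P u)^T *m P b)
                  else if moved b a then mxvec ((P a)^T *m P u) else 0
  | _ => 0 end.
have [eps eps0 {}sep] := separating_perturb h sep.
pose q a := if a == u then P v + eps *: P u else P a.
apply: (spanning_generic gp (q := q)) => // W sW hW.
(* It is enough that [W] annihilates every perturbed tensor of the compressed graph. *)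
apply/eqP; rewrite -mxvec_eq0; apply/eqP; apply: sep => i.
pose f a b := P a *m W *m (P b)^T.
have fC a b : f a b = f b a by apply: form_sym.
have nvu : u \notin nbr F v by rewrite nbr_sym.
have h1 a b : [set a; b] \in F -> a != u -> b != u -> f a b = 0.
  by move=> abF au bu; have := hW a b abF; rewrite /q (negbTE au) (negbTE bu).
have h2 w : w \in nbr F u -> f v w + eps *: f u w = 0.
  move=> wN; have := hW u w; rewrite -in_nbr wN /q eqxx eq_sym.
  rewrite (negbTE (simple_neq sF wN)) => /(_ isT).
  by rewrite !mulmxDl -!scalemxAl.
(* For a common neighbour [w], the edge [vw] cancels the main term of [h2], and [eps] can be divided
   out. *)
have h3 w : w \in nbr F u -> w \in nbr F v -> f u w = 0.
  move=> wu wv; have := h2 w wu; rewrite h1 ?add0r -?in_nbr 1?eq_sym //.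
    by move/eqP; rewrite scaler_eq0 (negbTE eps0) => /eqP.
  by rewrite (simple_neq sF wu).
case: i => [[a b]|[i j]]; last first.
  by rewrite /= scaler0 addr0 mxvec_skew -{1}sW mxE subrr;
    apply/matrixP => a b; rewrite !mxE mul0rn.
have movedE x y : moved x y -> [set x; y] \in compress F u v.
  by rewrite in_compress // => /andP[/eqP-> /setDP[-> _]]; rewrite eqxx !orbT.
have movedN x y : [set x; y] \in F -> moved x y = false.
  by apply: contraTF => /andP[/eqP-> /setDP[_]]; rewrite in_nbr.
have moved_u x : moved u x = false by rewrite /moved (negbTE uv).
have moved_r x : moved x u = false.
  by rewrite /moved in_setD (negbTE (nbr_irr u sF)) !andbF.
have movedv x : moved x v = false by rewrite /moved in_setD (negbTE nuv) !andbF.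
rewrite linearD /= mulmxDr linearZ /= -scalemxAr.
case: ifP => [abC|abC]; last first.
  have -> : moved a b = false by apply: contraFF abC; apply: movedE.
  have -> : moved b a = false.
    by apply: contraFF abC => /movedE; rewrite setUC.
  by rewrite !trmx0 !mulmx0 scaler0 addr0.
rewrite mxvec_form -/(f a b).
have key x y : (x == v) && (y \in nbr F u) ->
   f x y + eps *: (if moved x y then f u y else 0) = 0.
  case/andP=> /eqP-> yN; rewrite /moved eqxx in_setD yN /= andbT.
  case: ifP => yv; first exact: h2.
  rewrite scaler0 addr0; apply: h1; first by rewrite -in_nbr (negbFE yv).
    by rewrite eq_sym.
  by rewrite eq_sym; apply: simple_neq yN.
have hE : mxvec W *m (if moved a b then mxvec ((P u)^T *m P b)
      else if moved b a then mxvec ((P a)^T *m P u) else 0)^T =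
    if moved a b then f u b else if moved b a then f u a else 0.
  by do 2?case: ifP => _; rewrite ?mxvec_form // ?trmx0 ?mulmx0 //; apply: fC.
rewrite hE; move: abC; rewrite in_compress //.
case/orP => [/and3P[abF ua ub]|].
  rewrite movedN // movedN 1?setUC // scaler0 addr0.
  by apply: h1; rewrite // eq_sym.
case/orP => [hab|]; first have := key a b hab.
  by move: (hab) => /andP[/eqP-> _]; rewrite movedv; case: ifP.
case/orP => [hba|]; first have := key b a hba.
  by move: (hba) => /andP[/eqP-> _]; rewrite movedv fC.
case/orP => /andP[/eqP-> /setIP[wu wv]]; rewrite moved_u moved_r scaler0 addr0.
  exact: h3.
by rewrite fC; apply: h3.
Qed.

End Moves.

(** * Explicit points for the disjoint union of $K_4$ and $K_{3,3}$ *)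

Section K4K33.
Variables (R : realType) (n t : nat) (p : 'M[R]_(n, t)).
Hypothesis gp : generic p.

(* [K_4] on entries 0 to 3 of [L], and [K_{3,3}] between entries 4 to 6 and
   7 to 9. *)
Lemma spanning_K4_K33 (F : {set {set 'I_n}}) x0 (L : seq 'I_n) : (5 <= t)%N ->
  uniq L -> size L = 10%N ->
  (forall i j, (i < j < 4)%N -> [set nth x0 L i; nth x0 L j] \in F) ->
  (forall i j, (4 <= i < 7)%N -> (7 <= j < 10)%N ->
     [set nth x0 L i; nth x0 L j] \in F) ->
  generic_spanning p 5 F.
Proof.
move=> t5 uL sL hK4 hK33.
pose e (i : nat) : 'rV[R]_5 := delta_mx 0 (inord i).
(* The edges of $K_4$, placed at unit vectors, kill the off-diagonal entries among the first four
   coordinates. The nine edges of $K_{3,3}$ give an invertible system for the nine remaining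
   entries: the first four diagonal ones and the last column. *)
pose pts := [:: e 0%N; e 1%N; e 2%N; e 3%N; e 4%N; e 0%N + e 1%N + e 2%N + e 3%N;
  e 1%N + 2 *: e 2%N + 3 *: e 3%N; e 4%N; e 0%N + e 1%N; e 2%N - e 3%N].
pose q x : 'rV[R]_5 := nth 0 pts (index x L).
apply: (spanning_generic gp (q := q)) => // W sW hW.
pose w (x y : 'rV[R]_5) := (x *m W *m y^T) 0 0.
have wDl x x' y : w (x + x') y = w x y + w x' y by rewrite /w !mulmxDl mxE.
have wZl c x y : w (c *: x) y = c * w x y by rewrite /w -!scalemxAl mxE.
have wC x y : w x y = w y x by rewrite /w form_sym.
have wDr x y y' : w x (y + y') = w x y + w x y' by rewrite wC wDl ![w _ x]wC.
have wNr x y : w x (- y) = - w x y.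
  by rewrite wC -scaleN1r wZl mulN1r wC.
have wE i j : W i j = w (e i) (e j).
  by rewrite /w -rowE trmx_delta -colE !mxE !inord_val.
have qE i j : (i < 10)%N -> (j < 10)%N -> [set nth x0 L i; nth x0 L j] \in F ->
    w (nth 0 pts i) (nth 0 pts j) = 0.
  by move=> i10 j10 /hW; rewrite /q !index_uniq ?sL // /w => ->; rewrite mxE.
have f4 i j : (i < j < 4)%N -> w (nth 0 pts i) (nth 0 pts j) = 0.
  by move=> h; apply: qE (hK4 i j h); lia.
have f33 i j : (4 <= i < 7)%N -> (7 <= j < 10)%N ->
    w (nth 0 pts i) (nth 0 pts j) = 0.
  by move=> h h'; apply: qE (hK33 i j h h'); lia.
have := (f4 0 1 isT, f4 0 2 isT, f4 0 3 isT, f4 1 2 isT, f4 1 3 isT, f4 2 3 isT)%N.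
have := (f33 4 7 isT isT, f33 4 8 isT isT, f33 4 9 isT isT, f33 5 7 isT isT,
  f33 5 8 isT isT, f33 5 9 isT isT, f33 6 7 isT isT, f33 6 8 isT isT,
  f33 6 9 isT isT)%N.
rewrite /= !(wDl, wZl, wDr, wNr).
have [a aE] : exists a, forall i j, w (e i) (e j) = a i j.
  by exists (fun i j => w (e i) (e j)).
have aC i j : a i j = a j i by rewrite -!aE wC.
rewrite !aE (aC 1 0)%N (aC 2 0)%N (aC 3 0)%N (aC 4 0)%N (aC 2 1)%N (aC 4 1)%N.
rewrite (aC 3 1)%N (aC 3 2)%N (aC 4 2)%N (aC 4 3)%N => h33 h4.
have wij i j : (j < 5)%N -> (i <= j)%N -> a i j = 0.
  case: h4 h33 => [[[[[k1 k2] k3] k4] k5] k6].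
  rewrite k1 k2 k3 k4 k5 k6 => -[[[[[[[[h1 h2] h3] h4] h5] h6] h7] h8] h9].
  by case: j i => [|[|[|[|[|j]]]]] // [|[|[|[|[|i]]]]] // _ _; lra.
apply/matrixP => i j; rewrite wE aE mxE.
by have [ij|/ltnW ij] := leqP i j; [|rewrite aC //]; apply: wij.
Qed.

End K4K33.

Local Close Scope ring_scope.

(** * Graphs of small degree *)

Section SmallDegree.
Variables (R : realType) (n t : nat) (p : 'M[R]_(n, t)).
Hypothesis gp : generic p.
Implicit Types F : {set {set 'I_n}}.

Lemma spanning_rank0 F : generic_spanning p 0 F.
Proof. by move=> W _ _; apply: flatmx0. Qed.

Lemma simple_subdel F v e : simple F -> simple (del F v :\ e).
Proof. by move=> sF; apply: simpleS (subD1set _ _) (simple_del v sF). Qed.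

Lemma subdel_sub F v e : del F v :\ e \subset F.
Proof. by apply: subset_trans (subD1set _ _) (del_sub _ _). Qed.

Lemma spanning_card1 F : 1 <= t -> simple F -> #|F| = 1 ->
  generic_spanning p 1 F.
Proof.
move=> t1 sF cF; have [e eF] : exists e, e \in F by apply/card_gt0P; rewrite cF.
have [v [w [vw eE]]] := simpleP sF eF; have vS : nbr F v != set0.
  by apply: (edge_support eF) => //; rewrite eE set21.
apply: (spanning_0ext gp (v := v)) => //; last exact: spanning_rank0.
by rewrite -card_gt0 in vS; have := card_del v sF; lia.
Qed.

Lemma spanning_card3 F : 2 <= t -> simple F -> #|F| = 3 -> maxdeg F 2 ->
  generic_spanning p 2 F.
Proof.
move=> t2 sF cF dF; have [d1|[v dv]] := maxdeg_case dF; last first.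
  apply: (spanning_0ext gp (v := v)) => //; apply: spanning_card1.
  - exact: ltnW.
  - exact: simple_del.
  - by have := card_del v sF; lia.
have [e eF] : exists e, e \in F by apply/card_gt0P; rewrite cF.
have [v [w [vw eE]]] := simpleP sF eF.
have dv : #|nbr F v| = 1.
  have := d1 v; have : nbr F v != set0; last by rewrite -card_gt0; lia.
  by apply: (edge_support eF) => //; rewrite eE set21.
have [f fF df] := edge_avoid_in (X := nbr F v) (d := 1) (k := 1) sF
  (fun x _ => d1 x) (eq_leq dv) ltac:(by rewrite cF).
apply: (spanning_1ext gp (v := v) (e := f)) => //; apply: spanning_card1.
- exact: ltnW.
- exact: simple_subdel.
by have := card_del_edge sF fF df; lia.
Qed.

(** In dimension 3 the tensors at [x] and those at [y] span spaces that share the symmetric product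
    of $p_x$ and $p_y$, so the six edges of two such claws are dependent. *)
Definition no_claw_pair F := forall x y, x != y -> y \notin nbr F x ->
  #|nbr F x| = 3 -> #|nbr F y| = 3 -> False.

Lemma maxdeg2_no_claw_pair F : maxdeg F 2 -> no_claw_pair F.
Proof. by move=> h x y _ _; have := h x; lia. Qed.

(** A vertex of degree 3 or 2 is removed; after degree 3 the absence of a second nonadjacent claw
    keeps the remaining degrees at most 2. A matching is first compressed at a far pair. *)
Lemma spanning_card6 F : 3 <= t -> simple F -> #|F| = 6 -> maxdeg F 3 ->
  no_claw_pair F -> generic_spanning p 3 F.
Proof.
move=> t3; have [k] := ubnP #|[set w | nbr F w != set0]|.
elim: k F => // k IH F ltk sF cF dF cfF.
have [d2|[v dv]] := maxdeg_case dF; last first.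
  apply: (spanning_0ext gp (v := v)) => //; apply: spanning_card3.
  - exact: ltnW.
  - exact: simple_del.
  - by have := card_del v sF; lia.
  move=> w; have [->|wv] := eqVneq w v; first by rewrite nbr_del_id cards0.
  have [wN|wN] := boolP (w \in nbr F v).
    rewrite nbr_del 1?eq_sym //; have := dF w.
    by rewrite (cardsD1 v) nbr_sym wN; lia.
  have := subset_leq_card (nbr_sub w (del_sub F v)).
  have := dF w; have := @cfF v w; rewrite eq_sym wv wN dv => /(_ isT isT erefl).
  by move=> ?; case: (#|nbr F w| =P 3) => // ?; lia.
have [d1|[v dv]] := maxdeg_case d2; last first.
  have [f fF df] := edge_avoid_in (X := nbr F v) (d := 2) (k := 2) sF
    (fun x _ => d2 x) (eq_leq dv) ltac:(by rewrite cF).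
  apply: (spanning_1ext gp (v := v) (e := f)) => //; apply: spanning_card3.
  - exact: ltnW.
  - exact: simple_subdel.
  - by have := card_del_edge sF fF df; lia.
  - exact: maxdegS (subdel_sub _ _ _) d2.
have [u [v [uv nuv uN vN dN]]] := far_pair sF d1 ltac:(by rewrite cF).
have dF' : maxdeg (compress F u v) 2.
  apply: maxdeg_compress => //; rewrite card_disjoint_nbr //.
  exact: leq_add (d1 u) (d1 v).
apply: (spanning_compress gp sF uv nuv) => //; apply: IH.
- exact: leq_trans (support_compress sF uv dN uN vN) _.
- exact: simple_compress.
- by rewrite card_compress.
- by move=> w; apply: leqW.
- exact: maxdeg2_no_claw_pair.
Qed.

(** Compressing a far pair gives [v] degree 4, 3 or 2: degree 4 allows removing [v], degree 3
    removing [v] and an edge, and degree 2 preserves the hypotheses with fewer nonisolated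
    vertices. *)
Lemma spanning_card10_low F : 4 <= t -> simple F -> #|F| = 10 -> maxdeg F 2 ->
  generic_spanning p 4 F.
Proof.
move=> t4; have [k] := ubnP #|[set w | nbr F w != set0]|.
elim: k F => // k IH F ltk sF cF dF.
have [u [v [uv nuv uN vN dN]]] := far_pair sF dF ltac:(by rewrite cF).
have sF' := simple_compress sF nuv; have cF' := card_compress sF uv nuv.
have dv' : #|nbr (compress F u v) v| = #|nbr F u| + #|nbr F v|.
  by rewrite nbr_compress_v // card_disjoint_nbr.
have dG := maxdeg_del_compress sF uv dF.
have du := dF u; have dv := dF v; have cd := card_del v sF'.
rewrite -!card_gt0 in uN vN.
apply: (spanning_compress gp sF uv nuv) => //.
have [D4|nD4] := eqVneq (#|nbr F u| + #|nbr F v|) 4.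
  apply: (spanning_0ext gp (v := v)) => //; first by rewrite dv'.
  apply: spanning_card6; [exact: ltnW | exact: simple_del | lia | | ].
    by move=> w; apply: leqW.
  exact: maxdeg2_no_claw_pair.
have dF' : maxdeg (compress F u v) 3.
  apply: maxdeg_compress => [//|//|//|w|]; first exact: leqW.
  by rewrite card_disjoint_nbr //; lia.
have [D3|nD3] := eqVneq (#|nbr F u| + #|nbr F v|) 3.
  rewrite D3 in dv'.
  have [f fF df] := edge_avoid_in (X := nbr (compress F u v) v) (d := 3) (k := 3)
    sF' (fun x _ => dF' x) (eq_leq dv') ltac:(by rewrite cF' cF).
  apply: (spanning_1ext gp (v := v) (e := f)) => //; apply: spanning_card6.
  - exact: ltnW.
  - exact: simple_subdel.
  - by have := card_del_edge sF' fF df; lia.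
  - by apply: maxdegS (subD1set _ _) _ => w; apply: leqW.
  - exact/maxdeg2_no_claw_pair/(maxdegS (subD1set _ _)).
apply: IH => //; last by apply: maxdeg_compress => //; rewrite card_disjoint_nbr //; lia.
- by apply: leq_trans (support_compress sF uv dN _ _) _; rewrite -?card_gt0.
- by rewrite cF'.
Qed.

End SmallDegree.

(** * Ten edges of maximum degree 3, and fifteen edges with a good pair *)

Section Degree3.
Variables (R : realType) (n t : nat) (p : 'M[R]_(n, t)).
Hypothesis gp : generic p.
Implicit Types F : {set {set 'I_n}}.

(** The claws at [x] and [y] share no edge, so they account for all six edges. *)
Lemma claw_pair_cover F x y : simple F -> #|F| = 6 -> y \notin nbr F x ->
  #|nbr F x| = 3 -> #|nbr F y| = 3 -> x != y ->
  forall a b, b \in nbr F a -> [|| a == x, a == y, b == x | b == y].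
Proof.
move=> sF cF nxy dx dy xy a b; rewrite in_nbr => abF.
have := card_del y (simple_del x sF); have := card_del x sF.
have -> : nbr (del F x) y = nbr F y.
  rewrite nbr_del //; apply/setDidPl; rewrite disjoint_sym disjoints1.
  by rewrite nbr_sym.
move=> c1 c2; have /eqP : #|del (del F x) y| = 0 by lia.
rewrite cards_eq0 => /eqP/setP/(_ [set a; b]); rewrite !inE abF /= !negb_or.
by rewrite ![_ == a]eq_sym ![_ == b]eq_sym; do 4!case: (_ == _).
Qed.

(* If the first choice of [e] leaves two disjoint claws centred at [x] and [y],
   then [nbr F x] and [nbr F y] are not both equal to [nbr F v], so an edge at
   [x], say, avoids [nbr F v]; removing that one instead is harmless. *)
Lemma exists_no_claw_del F v : simple F -> #|F| = 10 -> maxdeg F 3 ->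
  K33_free F -> #|nbr F v| = 3 ->
  exists e, [/\ e \in F, [disjoint e & nbr F v] & no_claw_pair (del F v :\ e)].
Proof.
move=> sF cF dF kF dv.
have cG e : e \in F -> [disjoint e & nbr F v] -> #|del F v :\ e| = 6.
  by move=> eF de; have := card_del_edge sF eF de; lia.
have nbrG e x : #|nbr (del F v :\ e) x| = 3 -> nbr (del F v :\ e) x = nbr F x.
  move=> dx; apply/eqP; rewrite eqEcard dx dF andbT.
  exact/nbr_sub/subdel_sub.
have notin e x : e \in F -> #|nbr (del F v :\ e) x| = 3 -> x \notin e.
  move=> eF dx; apply/negP => xe; have [y yN eE] := edge_nbr sF eF xe.
  by move: yN; rewrite -(nbrG _ _ dx) in_nbr -eE setD11.
have vout e x : #|nbr (del F v :\ e) x| = 3 -> v \notin nbr F x.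
  move=> dx; rewrite -(nbrG _ _ dx); apply/negP => /(subsetP (nbr_sub x (subD1set _ _))).
  by rewrite in_nbr_del eqxx !andbF.
have vneq e x : #|nbr (del F v :\ e) x| = 3 -> x != v.
  move=> dx; apply/eqP => xv; rewrite xv in dx.
  have := subset_leq_card (nbr_sub v (subD1set (del F v) e)).
  by rewrite nbr_del_id cards0 dx.
have [e eF de] := edge_avoid_in (X := nbr F v) (d := 3) (k := 3) sF
  (fun x _ => dF x) (eq_leq dv) ltac:(by rewrite cF).
have key x y : x != y -> y \notin nbr (del F v :\ e) x ->
    #|nbr (del F v :\ e) x| = 3 -> #|nbr (del F v :\ e) y| = 3 ->
    nbr F x != nbr F v ->
    exists e, [/\ e \in F, [disjoint e & nbr F v] & no_claw_pair (del F v :\ e)].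
  move=> xy nxy dx dy NxNv.
  have cover := claw_pair_cover (simple_subdel v e sF) (cG e eF de) nxy dx dy xy.
  have dFx : #|nbr F x| = 3 by rewrite -(nbrG _ _ dx).
  have dFy : #|nbr F y| = 3 by rewrite -(nbrG _ _ dy).
  have [z zx zv] : exists2 z, z \in nbr F x & z \notin nbr F v.
    apply/subsetPn; apply: contra NxNv => s.
    by rewrite eqEcard s dFx dv.
  have fF : [set x; z] \in F by rewrite -in_nbr.
  have df : [disjoint [set x; z] & nbr F v].
    rewrite disjoints_subset subUset !sub1set !in_setC zv andbT nbr_sym.
    exact: vout dx.
  exists [set x; z]; split=> // x' y' xy' nxy' dx' dy'.
  have cover' := claw_pair_cover (simple_subdel v [set x; z] sF) (cG _ fF df)
    nxy' dx' dy' xy'.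
  (* The claw at [y] survives the new choice. If [y] were not a centre of the new pair, its three
     neighbours would all lie among the two new centres. *)
  have yx'y' : y \in [set x'; y'].
    apply: contraT; rewrite in_set2 negb_or => /andP[yx' yy'].
    have : nbr F y \subset [set x'; y'].
      apply/subsetP => w wN; have := cover' y w.
      rewrite (negbTE yx') (negbTE yy') /= in_set2; apply.
      move: (wN); rewrite -(nbrG _ _ dy) !in_nbr => /setD1P[_ wD].
      rewrite in_setD1 wD andbT; apply: contraTneq nxy => wE.
      have : y \in [set x; z] by rewrite -wE set21.
      rewrite in_set2 eq_sym (negbTE xy) /= => /eqP->.
      by rewrite (nbrG _ _ dx) negbK.
    by move/subset_leq_card; rewrite dFy cards2; case: (x' != y').
  (* Every edge at the other centre [a], except possibly [e], has to meet [x] or [y]; as [a] is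
     neither and is not adjacent to [y], it has at most two neighbours. *)
  have final a : a != y -> y \notin nbr (del F v :\ [set x; z]) a ->
      #|nbr (del F v :\ [set x; z]) a| = 3 -> False.
    move=> ay nya da; have ax : a != x.
      by apply: contraTneq (notin _ _ fF da) => ->; rewrite set21.
    have dFa : #|nbr F a| = 3 by rewrite -(nbrG _ _ da).
    pose B := [set w | [set a; w] == e].
    have cB : #|B| <= 1.
      apply/card_le1P => w; rewrite inE => /eqP we w'.
      rewrite !inE -we; apply/eqP/eqP => [/set2_inj//|-> //].
    have : nbr F a \subset x |: B.
      apply/subsetP => w wN; rewrite in_setU1 inE orbC.
      have [//|we /=] := eqVneq [set a; w] e.
      have wy : w != y by apply: contraNneq nya => <-; rewrite (nbrG _ _ da).
      have := cover a w; rewrite (negbTE ax) (negbTE ay) (negbTE wy) orbF /=.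
      apply; rewrite in_nbr in_setD1 we /= -in_nbr in_nbr_del wN /=.
      rewrite eq_sym (vneq _ _ da) /=; apply: contraTneq wN => <-.
      exact: vout da.
    move/subset_leq_card; rewrite dFa cardsU1 => h.
    by have := leq_trans h (leq_add (leq_b1 _) cB).
  move: yx'y'; rewrite in_set2 => /orP[] /eqP yE; subst y.
    by apply: (final y'); rewrite // 1?eq_sym // nbr_sym.
  exact: (final x').
have [[x y] /= /and4P[xy nxy /eqP dx /eqP dy]|none] := pickP [pred xy : 'I_n * 'I_n |
  [&& xy.1 != xy.2, xy.2 \notin nbr (del F v :\ e) xy.1,
    #|nbr (del F v :\ e) xy.1| == 3 & #|nbr (del F v :\ e) xy.2| == 3]]; last first.
  exists e; split=> // x y xy nxy dx dy.
  by have := none (x, y); rewrite /= xy nxy dx dy.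
have [xE|] := eqVneq (nbr F x) (nbr F v); last exact: (key x y).
have [yE|] := eqVneq (nbr F y) (nbr F v); last first.
  by apply: (key y x); rewrite // 1?eq_sym // nbr_sym.
have := kF v x y; rewrite xE yE dv !(eq_sym v) (vneq _ _ dx) (vneq _ _ dy) xy.
by move=> /(_ isT isT isT erefl erefl).
Qed.

Lemma spanning_card10 F : 4 <= t -> simple F -> #|F| = 10 -> maxdeg F 3 ->
  K33_free F -> generic_spanning p 4 F.
Proof.
move=> t4 sF cF dF kF; have [d2|[v dv]] := maxdeg_case dF.
  exact: spanning_card10_low.
have [e [eF de cfG]] := exists_no_claw_del sF cF dF kF dv.
apply: (spanning_1ext gp (v := v) (e := e)) => //; apply: spanning_card6 => //.
- exact: ltnW.
- exact: simple_subdel.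
- by have := card_del_edge sF eF de; lia.
- exact: maxdegS (subdel_sub _ _ _) dF.
Qed.

(** A side of a $K_{3,3}$ that is left after compressing and deleting [v] consists of vertices whose
    neighbourhoods in [F] were untouched. Excluding such triples away from the pair therefore makes
    [spanning_card10] applicable. *)
Lemma spanning_good_pair F u v : 5 <= t -> simple F -> #|F| = 15 ->
  maxdeg F 3 -> good_pair F u v ->
  (forall x y z, x != y -> x != z -> y != z -> nbr F x = nbr F y ->
     nbr F x = nbr F z -> #|nbr F x| = 3 ->
     {in [:: x; y; z], forall a, [&& a != u, a != v & a \notin nbr F u :|: nbr F v]} ->
     False) ->
  generic_spanning p 5 F.
Proof.
move=> t5 sF cF dF /and4P[uv nuv D4 D5] kF.
have sF' := simple_compress sF nuv; have cF' := card_compress sF uv nuv.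
have vE : nbr (compress F u v) v = nbr F u :|: nbr F v by apply: nbr_compress_v.
have dG := maxdeg_del_compress sF uv dF.
have kG (G : {set {set 'I_n}}) : G \subset del (compress F u v) v -> K33_free G.
  move=> sG x y z xy xz yz xyE xzE; apply/negP => /eqP dx.
  have nsub a : nbr G a \subset nbr (compress F u v) a :\ v.
    apply: subset_trans (nbr_sub a sG) _; apply/subsetP => b.
    by rewrite in_nbr_del in_setD1 => /and3P[-> _ vb]; rewrite eq_sym vb.
  (* The union has at least 4 elements and the degrees sum to at most 6, so [u] keeps at most two
     neighbours; the neighbours of [v] lose [v]. Hence neither kind has degree 3 in [G]. *)
  have outside a : #|nbr G a| = 3 ->
     [/\ a != u, a != v, a \notin nbr F u :|: nbr F v & nbr G a = nbr F a].
    move=> da.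
    have au : a != u.
      apply/eqP => aE; have := subset_leq_card (subset_trans (nsub a) (subsetDl _ _)).
      rewrite da aE nbr_compress_u //; have := cardsUI (nbr F u) (nbr F v).
      have := dF u; have := dF v; lia.
    have av : a != v.
      apply/eqP => aE; have := subset_leq_card (nbr_sub a sG).
      by rewrite da aE nbr_del_id cards0.
    have aN : a \notin nbr F u :|: nbr F v.
      rewrite -vE; apply/negP => aN; have := subset_leq_card (nsub a).
      have := dF a; rewrite -(nbr_compress F au av) da.
      rewrite (cardsD1 v (nbr (compress F u v) a)) nbr_sym aN => h1 h2.
      by have := leq_trans h1 h2; rewrite ltnn.
    split=> //; apply/eqP; rewrite eqEcard da dF andbT.
    apply: subset_trans (subset_trans (nsub a) (subsetDl _ _)) _.
    rewrite nbr_compress_out //.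
    by apply: contra aN => aN; rewrite in_setU aN.
  have [xu xv xN xE] := outside x dx.
  have [yu yv yN yE] := outside y ltac:(by rewrite -xyE).
  have [zu zv zN zE] := outside z ltac:(by rewrite -xzE).
  apply: (kF x y z); rewrite -?xE -?yE -?zE // => a.
  rewrite !in_cons in_nil orbF => /or3P[]/eqP->; apply/and3P; split=> //.
have cd := card_del v sF'; rewrite vE in cd.
apply: (spanning_compress gp sF uv nuv) => //.
have [D|D] := eqVneq #|nbr F u :|: nbr F v| 5.
  apply: (spanning_0ext gp (v := v)) => //; first by rewrite vE.
  apply: spanning_card10 => //.
  - exact: ltnW.
  - exact: simple_del.
  - by lia.
  - exact: kG.
have {}D : #|nbr F u :|: nbr F v| = 4 by lia.
have dN : {in nbr F u :|: nbr F v, forall x, #|nbr (compress F u v) x| <= 3}.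
  move=> x xN; rewrite nbr_compress //.
    apply: contraTneq xN => ->; rewrite in_setU negb_or nbr_irr //=.
    by rewrite nbr_sym.
  by apply: contraTneq xN => ->; rewrite in_setU negb_or nbr_irr // nuv.
(* The four neighbours of [v] keep degree at most 3, so they meet at most twelve of the fifteen
   edges. *)
have [e eF de] := edge_avoid_in (k := 4) sF' dN (eq_leq D) ltac:(by rewrite cF' cF).
rewrite -vE in de.
apply: (spanning_1ext gp (v := v) (e := e)) => //; first by rewrite vE.
apply: spanning_card10.
- exact: ltnW.
- exact: simple_subdel.
- by have := card_del_edge sF' eF de; rewrite vE; lia.
- exact: maxdegS (subD1set _ _) dG.
- exact/kG/subD1set.
Qed.

End Degree3.

(** * Fifteen edges of maximum degree 3 *)

Section Card15.
Variables (R : realType) (n t : nat) (p : 'M[R]_(n, t)).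
Hypothesis gp : generic p.
Implicit Types F : {set {set 'I_n}}.

Section K33.
Variables (F : {set {set 'I_n}}) (x y z : 'I_n).
Hypotheses (sF : simple F) (cF : #|F| = 15) (dF : maxdeg F 3).
Hypotheses (xy : x != y) (xz : x != z) (yz : y != z).
Hypotheses (xyE : nbr F x = nbr F y) (xzE : nbr F x = nbr F z).
Hypothesis dx : #|nbr F x| = 3.

(** The degree bound leaves no room for further neighbours, so the $K_{3,3}$ is a whole
    component. *)
Lemma nbr_K33 w : w \in nbr F x -> nbr F w = [set x; y; z].
Proof.
move=> wN; apply/esym/eqP; rewrite eqEcard -setUA cardsU1 cards2 !inE.
rewrite (negbTE xy) (negbTE xz) yz dF andbT !subUset !sub1set !(nbr_sym F w).
by rewrite -xyE -xzE wN.
Qed.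

Lemma nbr_K33_eq a : nbr F a = nbr F x -> a \in [set x; y; z].
Proof.
move=> aE; have [w wN] : exists w, w \in nbr F x by apply/card_gt0P; rewrite dx.
by rewrite -(nbr_K33 wN) nbr_sym aE.
Qed.

Lemma nbr_K33_in a : a \in [set x; y; z] -> nbr F a = nbr F x.
Proof. by rewrite !inE -orbA => /or3P[]/eqP->. Qed.

(* Two copies of [K_{3,3}] would contain eighteen edges. *)
Lemma K33_unique a b c : a != b -> a != c -> b != c -> nbr F a = nbr F b ->
  nbr F a = nbr F c -> #|nbr F a| = 3 ->
  {in [:: a; b; c], forall w, w \notin nbr F x} -> x \in [:: a; b; c].
Proof.
move=> ab ac bc abE acE da xN; apply: contraT.
rewrite !inE !negb_or => /and3P[xa xb xc].
have [aX|aX] := boolP (a \in [set x; y; z]).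
  have wX w : nbr F w = nbr F a -> w \in [set x; y; z].
    by rewrite (nbr_K33_in aX) => /nbr_K33_eq.
  have : x |: (a |: (b |: [set c])) \subset [set x; y; z].
    rewrite !subUset !sub1set aX (wX b (esym abE)) (wX c (esym acE)).
    by rewrite in_setU in_set2 eqxx.
  move/subset_leq_card; rewrite -setUA !cardsU1 !cards1 !in_setU1 !in_set1.
  rewrite (negbTE xa) (negbTE xb) (negbTE xc) (negbTE ab) (negbTE ac) (negbTE bc).
  by rewrite (negbTE xy) (negbTE xz) (negbTE yz).
have nE : nbr F a != nbr F x by apply: contraNneq aX => /nbr_K33_eq.
have out w : nbr F w = nbr F a -> w \notin [set x; y; z].
  by move=> wE; apply: contra nE => /nbr_K33_in <-; rewrite wE.
have bX := out b (esym abE); have cX := out c (esym acE).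
have uL : uniq [:: x; y; z; a; b; c].
  move: aX bX cX; rewrite !inE !negb_or -!andbA.
  move=> /and3P[ax ay az] /and3P[bx by_ bz] /and3P[cx cy cz].
  rewrite /= !inE !negb_or xy xz yz ab ac bc ![x == _]eq_sym ![y == _]eq_sym.
  by rewrite ![z == _]eq_sym ax ay az bx by_ bz cx cy cz.
have irr w : w \notin nbr F w by apply: nbr_irr.
have : \sum_(w <- [:: x; y; z; a; b; c]) #|nbr F w| <= #|F|.
  have xE w : w \in [:: x; y; z] -> nbr F w = nbr F x.
    by rewrite !inE => /or3P[]/eqP->.
  have aE w : w \in [:: a; b; c] -> nbr F w = nbr F a.
    by rewrite !inE => /or3P[]/eqP->.
  apply: leq_sum_stars => // v w.
  rewrite -[[:: x; y; z; a; b; c]]/([:: x; y; z] ++ [:: a; b; c]) !mem_cat.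
  case/orP=> vL /orP[] wL.
  - by rewrite (xE v) // -(xE w) // irr.
  - by rewrite (xE v) // xN.
  - by rewrite nbr_sym (xE w) // xN.
  - by rewrite (aE v) // -(aE w) // irr.
by rewrite !big_cons big_nil -xyE -xzE -abE -acE dx da cF.
Qed.

Lemma disjoint_K33 v : v \notin [set x; y; z] -> [disjoint nbr F x & nbr F v].
Proof.
move=> vX; rewrite disjoints_subset; apply/subsetP => w wN; rewrite inE nbr_sym.
by rewrite nbr_K33.
Qed.

(* Twelve edges avoid [v], and the three vertices of the [K_{3,3}] together
   with [b] and [c] would be independent with thirteen edges among them. *)
Lemma K4_of_cubic v b c : v \notin [set x; y; z] -> v \notin nbr F x ->
  #|nbr F v| = 3 -> b \in nbr F v -> c \in nbr F v -> b != c ->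
  #|nbr F b| = 3 -> #|nbr F c| = 3 -> [set b; c] \in F.
Proof.
move=> vX vN dv bN cN bc db dc; apply: contraT => nbc.
have dis := disjoint_K33 vX.
have vw w : w \in nbr F v -> w \notin nbr F x by move=> wN; rewrite (disjointFl dis).
have wX w : w \in nbr F v -> w \notin [set x; y; z].
  move=> wN; apply: contra vN => wX; rewrite -(nbr_K33_in wX).
  by rewrite nbr_sym.
have sD := simple_del v sF; have cD := card_del v sF.
have irr w : w \notin nbr (del F v) w by apply: nbr_irr.
have xD w : w \in [:: x; y; z] -> nbr (del F v) w = nbr F x.
  rewrite !inE orbA => wL; have wS : w \in [set x; y; z] by rewrite !inE.
  rewrite nbr_del; last by apply: contraNneq vX => ->.
  by rewrite nbr_K33_in //; apply/setDidPl; rewrite disjoint_sym disjoints1.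
have bD w : w \in nbr F v -> #|nbr F w| = 3 -> #|nbr (del F v) w| = 2.
  move=> wN dw; rewrite nbr_del; last by apply: simple_neq wN.
  by move: dw; rewrite (cardsD1 v) nbr_sym wN => -[].
have : \sum_(w <- [:: x; y; z; b; c]) #|nbr (del F v) w| <= #|del F v|.
  apply: leq_sum_stars => //.
    have := wX b bN; have := wX c cN; rewrite !inE !negb_or -!andbA.
    move=> /and3P[cx cy cz] /and3P[bx by_ bz].
    rewrite /= !inE !negb_or xy xz yz bc ![x == _]eq_sym ![y == _]eq_sym.
    by rewrite ![z == _]eq_sym cx cy cz bx by_ bz.
  move=> u w; rewrite -[[:: x; y; z; b; c]]/([:: x; y; z] ++ [:: b; c]) !mem_cat.
  have bcE a : a \in [:: b; c] -> a \in nbr F v by rewrite !in_cons in_nil orbF => /orP[]/eqP->.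
  case/orP=> uL /orP[] wL.
  - by rewrite (xD u) // -(xD w) // irr.
  - by rewrite (xD u) // vw // bcE.
  - by rewrite nbr_sym (xD w) // vw // bcE.
  - rewrite in_nbr_del; apply/negP => /and3P[h _ _]; move: h.
    move: uL wL; rewrite !inE => /orP[]/eqP-> /orP[]/eqP->; apply/negP => //.
    + by rewrite -in_nbr nbr_irr.
    + by rewrite setUC.
    + by rewrite -in_nbr nbr_irr.
rewrite !big_cons big_nil (bD b) // (bD c) // !xD ?inE ?eqxx ?orbT // dx.
suff -> : #|del F v| = 12 by [].
by apply: (@addnI 3); rewrite -[in LHS]dv cD cF.
Qed.

(** A vertex of degree 1 or 2 outside the $K_{3,3}$ forms a good pair with [x]. Otherwise every
    nonisolated vertex outside has degree 3, and the six remaining edges form a $K_4$. *)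
Lemma spanning_card15_K33 : 5 <= t -> generic_spanning p 5 F.
Proof.
move=> t5.
have xX : x \in [set x; y; z] by rewrite !inE eqxx.
have [v /= /and4P[vX vN d0 d3]|none] := pickP [pred v |
  [&& v \notin [set x; y; z], v \notin nbr F x, 0 < #|nbr F v| & #|nbr F v| < 3]].
  apply: (spanning_good_pair gp t5 sF cF dF (u := x) (v := v)).
    rewrite /good_pair vN card_disjoint_nbr ?dx; last exact: disjoint_K33.
    by apply/and4P; split=> //; apply: contraNneq vX => <-.
  move=> a b c ab ac bc abE acE da out.
  (* Any triple left to exclude would have to contain [x], which belongs to the compressed pair. *)
  have xL : x \in [:: a; b; c].
    apply: (K33_unique ab ac bc abE acE da) => w /out/and3P[_ _ +].
    by rewrite in_setU negb_or => /andP[].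
  by have := out x xL; rewrite eqxx.
have [e eF de] := edge_avoid_in (X := nbr F x) (d := 3) (k := 3) sF
  (fun x _ => dF x) (eq_leq dx) ltac:(by rewrite cF).
have [v [w [vw eE]]] := simpleP sF eF.
have vN : v \notin nbr F x by rewrite (disjointFr de) // eE set21.
have wv : w \in nbr F v by rewrite in_nbr -eE.
have vX : v \notin [set x; y; z].
  apply/negP => /nbr_K33_in vE; rewrite vE in wv.
  by have := disjointFl de wv; rewrite eE set22.
have deg3 a : a \notin [set x; y; z] -> a \notin nbr F x -> nbr F a != set0 ->
    #|nbr F a| = 3.
  rewrite -card_gt0 => aX aN a0; have := none a.
  by rewrite /= aX aN a0 /= => lt3; apply/eqP; rewrite eqn_leq dF leqNgt lt3.
have dv : #|nbr F v| = 3 by apply: deg3 => //; apply/set0Pn; exists w.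
have dis := disjoint_K33 vX.
have NvX a : a \in nbr F v -> a \notin [set x; y; z].
  by move=> aN; apply: contra vN => aX; rewrite -(nbr_K33_in aX) nbr_sym.
have NvN a : a \in nbr F v -> a \notin nbr F x.
  by move=> aN; rewrite (disjointFl dis).
have dNv a : a \in nbr F v -> #|nbr F a| = 3.
  move=> aN; apply: deg3; [exact: NvX | exact: NvN |].
  by apply/set0Pn; exists v; rewrite nbr_sym.
have XN a : a \in [set x; y; z] -> a \notin nbr F x.
  by move=> /nbr_K33_in <-; apply: nbr_irr.
(* The $K_4$ is [A], and the sides of the $K_{3,3}$ are [B] and [C]. *)
pose A := v :: enum (nbr F v); pose B := [:: x; y; z]; pose C := enum (nbr F x).
have BX a : a \in B -> a \in [set x; y; z] by rewrite !inE orbA.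
have sA : size A = 4 by rewrite /= -cardE dv.
have sC : size C = 3 by rewrite /= -cardE dx.
have uA : uniq A by rewrite /= mem_enum nbr_irr // enum_uniq.
have uBC : uniq (B ++ C).
  rewrite cat_uniq enum_uniq andbT; apply/andP; split.
    by rewrite /B /= !inE negb_or xy xz yz.
  apply/hasPn => a; rewrite mem_enum => aN.
  by apply: contraL aN => /BX/XN.
have inA a : (a \in A) = (a == v) || (a \in nbr F v) by rewrite in_cons mem_enum.
have dABC a : a \in B ++ C -> a \notin A.
  rewrite mem_cat inA negb_or => /orP[/BX aX|]; last first.
    rewrite mem_enum => aN; rewrite (disjointFr dis) // andbT.
    by apply: contraNneq vN => <-.
  apply/andP; split; first by apply: contraNneq vX => <-.
  by apply: contraL aX => /NvX.
apply: (spanning_K4_K33 gp (x0 := x) (L := A ++ B ++ C)) => //.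
- by rewrite cat_uniq uA uBC andbT; apply/hasPn.
- by rewrite !size_cat sA sC.
- move=> i j /andP[ij j4]; rewrite !nth_cat sA j4 (ltn_trans ij j4).
  set a := nth x A i; set b := nth x A j.
  have aA : a \in A by rewrite mem_nth ?sA // (ltn_trans ij).
  have bA : b \in A by rewrite mem_nth ?sA.
  have ab : a != b by rewrite nth_uniq ?sA ?(ltn_trans ij) // neq_ltn ij.
  move: aA bA ab; rewrite !inA.
  case/orP=> [/eqP->|aN] /orP[/eqP->|bN] ab.
  + by rewrite eqxx in ab.
  + by rewrite -in_nbr.
  + by rewrite setUC -in_nbr.
  + by apply: (K4_of_cubic vX vN dv) => //; apply: dNv.
- move=> i j /andP[i4 i7] /andP[j7 j10].
  have [iF jF iT jT jC] : [/\ (i < 4) = false, (j < 4) = false, i - 4 < 3,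
      (j - 4 < 3) = false & j - 4 - 3 < 3].
    by clear -i4 i7 j7 j10; split; lia.
  rewrite !nth_cat sA iF jF iT jT.
  have aB : nth x B (i - 4) \in B by rewrite mem_nth.
  have bC : nth x C (j - 4 - 3) \in C by rewrite mem_nth // sC.
  by rewrite -in_nbr (nbr_K33_in (BX _ aB)) -mem_enum.
Qed.

End K33.

Lemma spanning_card15 F : 5 <= t -> simple F -> #|F| = 15 -> maxdeg F 3 ->
  generic_spanning p 5 F.
Proof.
move=> t5; have [k] := ubnP #|[set w | nbr F w != set0]|.
elim: k F => // k IH F ltk sF cF dF.
have [[[x y] z] /= |none] := pickP [pred xyz : 'I_n * 'I_n * 'I_n |
  let: (x, y, z) := xyz in [&& x != y, x != z, y != z, nbr F x == nbr F y,
    nbr F x == nbr F z & #|nbr F x| == 3]].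
  case/and5P=> xy xz yz /eqP xyE /andP[/eqP xzE /eqP dx].
  by have := spanning_card15_K33 sF cF dF xy xz yz xyE xzE dx t5.
have kF : K33_free F.
  move=> x y z xy xz yz xyE xzE; have := none (x, y, z).
  by rewrite /= xy xz yz -xyE -xzE eqxx /= => /negbT.
have [[u v] /= gpF|nogood] := pickP [pred uv : 'I_n * 'I_n | good_pair F uv.1 uv.2].
  apply: (spanning_good_pair gp t5 sF cF dF gpF) => x y z xy xz yz xyE xzE dx _.
  by have := kF x y z xy xz yz xyE xzE; rewrite dx.
have [d2|[v dv]] := maxdeg_case dF; last first.
  have ng u w : ~~ good_pair F u w by apply/negbT/(nogood (u, w)).
  by have := no_cubic sF cF dF kF ng v; rewrite dv.
have [u [v [uv nuv uN vN dN]]] := far_pair sF d2 ltac:(by rewrite cF).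
(* As the pair is not good, its degrees sum to at most 3, so the compression keeps maximum degree
   3. *)
have := nogood (u, v); rewrite /= /good_pair uv nuv card_disjoint_nbr //=.
have D4 := leq_add (d2 u) (d2 v); rewrite (leq_trans D4) // andbT.
move=> /negbT; rewrite -leqNgt => D3.
apply: (spanning_compress gp sF uv nuv) => //; apply: IH.
- exact: leq_trans (support_compress sF uv dN uN vN) _.
- exact: simple_compress.
- by rewrite card_compress.
- by apply: maxdeg_compress => //; rewrite card_disjoint_nbr.
Qed.

End Card15.

(** * Bases of abstract matroids are generically independent *)

Section Main.
Variables (R : realType) (n t : nat) (p : 'M[R]_(n, t)).
Hypothesis gp : generic p.
Implicit Types F : {set {set 'I_n}}.

(** The induction contracts one vertex star at a time: [X] collects the deleted vertices, and [F]
    has as many edges as the rank that remains in dimension [s]. *)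
Lemma spans_generic_spanning (M : matroid (complete_edges n)) s
    (X : {set 'I_n}) F : t < n ->
  (forall v (L : {set 'I_n}), v \notin L -> #|L| = t.+1 -> circuit M (star v L)) ->
  rank M (complete_edges n) = 'C(t.+1, 2) ->
  s <= 5 -> #|X| + s = t -> simple F ->
  {in F, forall e : {set 'I_n}, [disjoint e & X]} ->
  #|F| = 'C(s.+1, 2) -> spans t M X F -> generic_spanning p s F.
Proof.
move=> hn hM rM; elim: s X F => [|s IH] X F s5 cX sF dX cF spF.
  exact: spanning_rank0.
have st : s < t by rewrite -cX addnS ltnS leq_addl.
have vX v : 0 < #|nbr F v| -> v \notin X.
  move=> /card_gt0P[w]; rewrite in_nbr => /dX.
  rewrite disjoints_subset => /subsetP/(_ v); rewrite set21 inE.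
  exact.
have cvX v : v \notin X -> #|v |: X| + s = t.
  by move=> vX'; rewrite cardsU1 vX' -cX addnS.
have dvX v : {in del F v, forall e : {set 'I_n}, [disjoint e & v |: X]}.
  move=> e; rewrite inE => /andP[eF ve]; rewrite disjoint_sym disjoints_subset.
  rewrite subUset sub1set inE ve /=; have := dX e eF.
  by rewrite disjoint_sym disjoints_subset.
have dF : maxdeg F s.+1.
  move=> v; have [v0|v0] := posnP #|nbr F v|; first by rewrite v0.
  exact: (spans_deg_leq hn hM sF cX (vX v v0) cF spF).
have [d|[v dv]] := maxdeg_case dF; last first.
  have v0 : v \notin X by apply: vX; rewrite dv.
  apply: (spanning_0ext gp (v := v)) => //; apply: (IH (v |: X)) => //.
  - exact: ltnW.
  - exact: cvX.
  - exact: simple_del.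
  - by have := card_del v sF; rewrite cF dv binS2 addnC => /addIn.
  - exact: spans_del.
case: s => [|s] in IH s5 cX cF st cvX dF d *.
  by apply: spanning_card1.
(* In dimension [s.+2] the degrees are now at most [s.+1]. Degree [s.+1] allows removing a vertex
   and an edge; if all degrees are at most [s], the results for small degrees apply, where
   [s <= 3]. *)
have [{}d|[v dv]] := maxdeg_case d.
  clear IH cvX dF; case: s => [|[|[|[|s]]]] // in s5 cX cF st d *.
  - by apply: spanning_card3 => // v; apply: leq_trans (d v) _.
  - apply: spanning_card6 => // [v|]; first by apply: leq_trans (d v) _.
    by apply: maxdeg2_no_claw_pair => v; apply: leq_trans (d v) _.
  - exact: spanning_card10_low.
  - exact: spanning_card15.
have v0 : v \notin X by apply: vX; rewrite dv.
have [e [eD de spe]] := spans_del_edge hn hM sF cX v0 dX dv rM spF.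
have eF : e \in F by apply: subsetP eD; apply: del_sub.
apply: (spanning_1ext gp (v := v) (e := e)) => //; apply: (IH (v |: X)) => //.
- exact: ltnW.
- exact: cvX.
- exact: simple_subdel.
- by move=> f /setD1P[_]; apply: dvX.
- have := card_del_edge sF eF de; rewrite cF dv binS2 binS2; lia.
Qed.

Definition clique (Y : {set 'I_n}) : {set {set 'I_n}} :=
  [set e in complete_edges n | e \subset Y].

Lemma card_clique Y : #|clique Y| = 'C(#|Y|, 2).
Proof.
by rewrite -cards_draws; apply: eq_card => e; rewrite !inE andbC.
Qed.

Lemma simple_clique Y : simple (clique Y).
Proof. by apply/subsetP => e /setIdP[]. Qed.

(** Each vertex of $K_{s+1}$ has degree [s], so the clique is built up by adding one vertex at a
    time through [spanning_0ext]. *)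
Lemma spanning_clique s (Y : {set 'I_n}) : s <= t -> #|Y| = s.+1 ->
  generic_spanning p s (clique Y).
Proof.
elim: s Y => [|s IH] Y st cY; first exact: spanning_rank0.
have [v vY] : exists v, v \in Y by apply/card_gt0P; rewrite cY.
have cYv : #|Y :\ v| = s.+1.
  by move: cY; rewrite (cardsD1 v) vY => -[].
apply: (spanning_0ext gp (v := v)) => //; first exact: simple_clique.
  rewrite -cYv; apply: eq_card => w.
  by rewrite in_nbr inE in_edges in_setD1 subUset !sub1set vY eq_sym.
have -> : del (clique Y) v = clique (Y :\ v).
  by apply/setP => e; rewrite !inE subsetD1 andbA.
by apply: IH; rewrite // ltnW.
Qed.

End Main.

(** * From spanning to linear independence, and maximality *)

Local Open Scope ring_scope.

Lemma card_sorted_pairs t : #|[set ij : 'I_t * 'I_t | (ij.1 <= ij.2)%N]| = 'C(t.+1, 2).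
Proof.
rewrite -sum1dep_card -(pair_big_dep xpredT (fun i j : 'I_t => (i <= j)%N) (fun _ _ => 1%N)) /=.
rewrite (exchange_big_dep xpredT) //=.
have E (j : 'I_t) : (\sum_(i < t | (i <= j)%N) 1)%N = j.+1.
  rewrite (eq_bigl (fun i : 'I_t => (i < j.+1)%N)) // (big_ord_narrow (ltn_ord j)).
  by rewrite sum1_card card_ord.
under eq_bigr do rewrite E; elim: (t) => [|m IH]; first by rewrite big_ord0.
by rewrite big_ord_recr /= IH [in RHS]binS2.
Qed.

(** The rows are the matrices $E_{ij}+E_{ji}$ with $i\le j$; the diagonal ones are $2E_{ii}$,
    nonzero in characteristic 0. *)
Lemma symmetric_basis (K : numFieldType) t :
  exists B : 'M[K]_('C(t.+1, 2), t * t),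
    row_free B /\ forall w : 'rV_('C(t.+1, 2)), (vec_mx (w *m B))^T = vec_mx (w *m B).
Proof.
pose P := [set ij : 'I_t * 'I_t | (ij.1 <= ij.2)%N].
have <- : #|P| = 'C(t.+1, 2) by apply: card_sorted_pairs.
pose b (k : 'I_#|P|) : 'M[K]_t :=
  delta_mx (enum_val k).1 (enum_val k).2 + delta_mx (enum_val k).2 (enum_val k).1.
pose B := \matrix_k mxvec (b k).
have BE (w : 'rV_#|P|) : vec_mx (w *m B) = \sum_k w 0 k *: b k.
  rewrite mulmx_sum_row linear_sum; apply: eq_bigr => k _.
  by rewrite linearZ /= rowK mxvecK.
exists B; split=> [|w]; last first.
  rewrite BE linear_sum; apply: eq_bigr => k _; rewrite linearZ /=; congr (_ *: _).
  by rewrite linearD /= !trmx_delta addrC.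
rewrite -kermx_eq0; apply/rowV0P => w /sub_kermxP wB; apply/rowP => k; rewrite mxE.
have := BE w; rewrite wB linear0 => /matrixP/(_ (enum_val k).1 (enum_val k).2).
rewrite mxE summxE (bigD1 k) //= big1 => [|l lk].
  rewrite !mxE !eqxx /= addr0 => /esym/eqP; rewrite mulf_eq0 => /orP[/eqP//|].
  by rewrite -natrD pnatr_eq0 addn_eq0.
have sk := enum_valP k; have sl := enum_valP l; rewrite !inE in sk sl.
have : enum_val l != enum_val k by rewrite (inj_eq enum_val_inj).
move: sk sl; rewrite !mxE; case: (enum_val k) (enum_val l) => [i j] [i' j'] /= le1 le2.
rewrite xpair_eqE ![i' == _]eq_sym ![j' == _]eq_sym => ne; apply/eqP.
rewrite mulf_eq0; apply/orP; right.
have -> : (i == i') && (j == j') = false by apply: negbTE.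
suff -> : (i == j') && (j == i') = false by rewrite addr0.
apply: contraNF ne => /andP[/eqP ij /eqP ji]; subst.
have e : i' == j' by rewrite -val_eqE /= eqn_leq le1 le2.
by rewrite (eq_sym j') e.
Qed.

Section Final.
Variables (R : realType) (n t : nat) (p : 'M[R]_(n, t)).
Hypothesis gp : generic p.

Lemma edge_tensor2 (a b : 'I_n) : a != b -> edge_tensor p [set a; b] =
  (row a p)^T *m row b p + (row b p)^T *m row a p.
Proof.
move=> ab; rewrite /edge_tensor big_setU1 ?in_set1 //= big_set1.
have -> : \sum_(j in [set a; b] | j != a) (row a p)^T *m row j p =
    (row a p)^T *m row b p.
  rewrite (big_pred1 b) // => j; rewrite !inE.
  by case: eqVneq => [->|]; rewrite ?(negbTE ab) //= andbT.
rewrite (big_pred1 a) // => j; rewrite !inE.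
by case: (eqVneq j b) => [->|]; rewrite ?andbF ?andbT ?orbF // eq_sym (negbTE ab).
Qed.

(** There are as many edges as the dimension of the space of symmetric matrices, so spanning tensors
    are independent. *)
Lemma spanning_free F : simple F -> #|F| = 'C(t.+1, 2) -> generic_spanning p t F ->
  free [seq edge_tensor p e | e in F].
Proof.
move=> sF cF spF; have [B [fB sB]] := symmetric_basis R t.
pose A := \matrix_(k < #|F|) mxvec (edge_tensor p (enum_val k)).
have fBA : row_free (B *m A^T).
  rewrite -kermx_eq0; apply/rowV0P => w /sub_kermxP wBA.
  suff W0 : vec_mx (w *m B) = 0.
    apply/eqP; rewrite -(mulmx_free_eq0 w fB) -(vec_mxK (w *m B)) W0.
    by rewrite linear0.
  apply: spF => // a b abF; rewrite !generic_pointE.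
  have ab : a != b by have := simple_neq sF (v := a) (w := b); rewrite in_nbr => /(_ abF).
  have : (w *m B *m A^T) 0 (enum_rank_in abF [set a; b]) = 0.
    by rewrite -mulmxA wBA mxE.
  set W := vec_mx (w *m B); rewrite -(vec_mxK (w *m B)) -/W.
  have -> : (mxvec W *m A^T) 0 (enum_rank_in abF [set a; b]) =
     (mxvec W *m (mxvec (edge_tensor p [set a; b]))^T) 0 0.
    rewrite !mxE; apply: eq_bigr => j _; rewrite !mxE.
    by rewrite enum_rankK_in.
  rewrite edge_tensor2 // linearD /= linearD /= mulmxDr !mxvec_form.
  rewrite (form_sym (row b p)) ?sB // -mulr2n -scaler_nat mxE => /eqP.
  rewrite mulf_eq0 pnatr_eq0 /= => /eqP h.
  by apply/matrixP => i j; rewrite !ord1 h mxE.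
(* The rank of [A] is at least that of [B *m A^T], which equals the number of rows of [A]. *)
have rA : row_free A.
  rewrite /row_free -mxrank_tr eqn_leq -{1}mxrank_tr trmxK rank_leq_row /=.
  rewrite {1}cF -{1}(eqP fBA).
  exact: mxrankM_maxr.
apply/(@freeP _ _ _ (image_tuple (edge_tensor p) F)) => k hk i.
have : (\row_i k i) *m A = 0.
  have := congr1 mxvec hk; rewrite linear0 linear_sum mulmx_sum_row => h; rewrite -[RHS]h.
  by apply: eq_bigr => j _; rewrite linearZ /= nth_image rowK mxE.
by move/eqP; rewrite mulmx_free_eq0 // => /eqP/rowP/(_ i); rewrite !mxE.
Qed.

(* All the tensors at [v] lie in the image of [x |-> p_v^T x + x^T p_v]. *)
Lemma star_not_free v (L : {set 'I_n}) : v \notin L -> #|L| = t.+1 ->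
  ~~ free [seq edge_tensor p e | e in star v L].
Proof.
move=> vL cL; pose f : {linear 'rV[R]_t -> 'M[R]_t} :=
  (mulmx (row v p)^T \+ (trmx \o mulmx (row v p)^T)).
have fE w : v != w -> edge_tensor p [set v; w] = linfun f (row w p).
  by move=> vw; rewrite edge_tensor2 // lfunE /= trmx_mul trmxK.
set Y := [seq edge_tensor p e | e in star v L].
have sY : size Y = t.+1 by rewrite size_image card_star.
apply/negP => fY; have : (\dim <<Y>> <= t)%N; last by rewrite (eqP fY) sY ltnn.
have sub : (<<Y>> <= linfun f @: fullv)%VS.
  apply/span_subvP => _ /imageP[_ /imsetP[w wL ->] ->].
  rewrite fE; last by apply: contraNneq vL => ->.
  by rewrite memv_img ?memvf.
apply: leq_trans (dimvS sub) _.
have dt : \dim {:'rV[R]_t} = t by rewrite dimvf dim_matrix; apply: mul1n.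
by rewrite -[leqRHS]dt -(limg_ker_dim (linfun f) fullv) leq_addl.
Qed.

Local Notation S := (symmetric_tensor_matroid p).

Lemma spanning_indep F : simple F -> #|F| = 'C(t.+1, 2) -> generic_spanning p t F ->
  F \in indep S.
Proof. by move=> sF cF spF; rewrite inE spanning_free // andbT. Qed.

Lemma clique_indep (Y : {set 'I_n}) : #|Y| = t.+1 -> clique Y \in indep S.
Proof.
move=> cY; apply: spanning_indep; first exact: simple_clique.
  by rewrite card_clique cY.
exact: (spanning_clique gp).
Qed.

(** A proper subset of the star misses a leaf [w], so it lies in the clique on [v] and the other [t]
    leaves, which is independent. *)
Lemma circuit_star_symmetric v (L : {set 'I_n}) : v \notin L -> #|L| = t.+1 ->
  circuit S (star v L).
Proof.
move=> vL cL; have sE : star v L \subset complete_edges n.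
  apply/subsetP => _ /imsetP[w wL ->]; rewrite in_edges.
  by apply: contraNneq vL => ->.
apply/minsetP; split.
  by rewrite inE sE inE sE /= star_not_free.
move=> B; rewrite inE => /andP[BE nB] sB; move: nB; apply: contraNeq => neB.
have [w wL wB] : exists2 w, w \in L & [set v; w] \notin B.
  have : ~~ (star v L \subset B) by move: neB; rewrite eqEsubset sB.
  by case/subsetPn => _ /imsetP[w wL ->] ?; exists w.
have cY : #|v |: (L :\ w)| = t.+1.
  rewrite cardsU1 in_setD1 (negbTE vL) andbF.
  by have := cardsD1 w L; rewrite wL cL => ->.
apply: indepS (clique_indep cY); apply/subsetP => e eB.
have /imsetP[x xL eE] := subsetP sB e eB.
rewrite inE (subsetP BE) // eE subUset !sub1set setU11 in_setU1 in_setD1 xL andbT.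
by apply/orP; right; apply: contraNneq wB => <-; rewrite -eE.
Qed.

Lemma mrankE (T : finType) (E : {set T}) (M : matroid E) : mrank M = rank M E.
Proof.
rewrite /mrank /rank; apply: eq_bigl => A.
by case iA: (A \in indep M) => //=; rewrite (indep_ground iA).
Qed.

(** The upper bound on the rank already follows from the star circuits; a clique on [t.+1] vertices
    attains it. *)
Lemma symmetric_tensor_abstract : (t < n)%N -> abstract_symmetric_tensor t S.
Proof.
move=> hn; apply/andP; split.
  rewrite mrankE eqn_leq; apply/andP; split.
    exact: (rank_tensor_leq hn circuit_star_symmetric).
  have [Y _ cY] : exists2 Y : {set 'I_n}, Y \subset setT & #|Y| = t.+1.
    by apply: exists_subset_card; rewrite cardsT card_ord.
  rewrite -cY -card_clique; apply: leq_card_rank (clique_indep cY) _.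
  exact: simple_clique.
apply/forallP => v; apply/forallP => L; apply/implyP => /andP[vL /eqP cL].
exact: circuit_star_symmetric.
Qed.

(** An independent set of [M] extends to a basis, to which the induction applies with nothing
    contracted yet. *)
Lemma abstract_weak_le (M : matroid (complete_edges n)) : (t <= 5)%N -> (t < n)%N ->
  abstract_symmetric_tensor t M -> weak_le M S.
Proof.
move=> t5 hn /andP[/eqP rM /forallP hM]; rewrite mrankE in rM.
have {}hM v (L : {set 'I_n}) : v \notin L -> #|L| = t.+1 -> circuit M (star v L).
  by move=> vL cL; have /forallP/(_ L) := hM v; rewrite vL cL eqxx.
apply/subsetP => A iA.
have [F [iF sAF sFE cF]] := rank_extend iA (indep_ground iA).
apply: indepS sAF _; apply: spanning_indep => //; first by rewrite cF rM.
apply: (spans_generic_spanning gp (M := M) (X := set0)) => //.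
- by rewrite cards0.
- by move=> e _; rewrite disjoint_sym disjoints_subset sub0set.
- by rewrite cF rM.
- by rewrite /spans -rM -cF -(rank_indep iF) rankS // subsetUl.
Qed.

End Final.

Theorem mainTheorem3 (R : realType) (t n : nat) (ht : (1 <= t <= 5)%N)
    (hn : (t.+1 <= n)%N) (p : 'M[R]_(n, t)) (hp : generic p) :
  unique_maximal_in (@abstract_symmetric_tensor n t)
    (symmetric_tensor_matroid p).
Proof.
have /andP[_ t5] := ht; have aS := symmetric_tensor_abstract hp hn.
have leS M := abstract_weak_le (M := M) hp t5 hn.
split=> [|M [aM maxM]]; last by apply/esym/maxM/leS.
split=> // M aM leSM; apply: val_inj; apply/eqP; rewrite eqEsubset.
by rewrite [X in _ && X]leSM andbT; apply: leS.
Qed.
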